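(* Let $\mathcal{F}$ be a family of extrapolation pairs on $\mathbb{R}^n$, and let $\Phi$ be a Young function with $1<i_\Phi\le I_\Phi<\infty$ and complementary function $\bar\Phi$. Let $u$ and $v$ be weights on $\mathbb{R}^n$ such that $v\in A_1$. Suppose that for some $p_0\in(0,\infty)$ and for every $w\in A_1$, $$\|f\|_{L^{p_0}(w)}\le C\,\|g\|_{L^{p_0}(w)},\qquad (f,g)\in\mathcal{F},$$ where $C$ is independent of $(f,g)$ and depends on $w$ only through $[w]_{A_1}$. Then there is a constant $C$ such that $$\int_{\mathbb{R}^n}\Phi(f^{p_0}u^{p_0})\,v\,dx\le C\int_{\mathbb{R}^n}\Phi(g^{p_0}u^{p_0})\,v\,dx,\qquad (f,g)\in\mathcal{F},$$ provided that there is a constant $K_0$ with $$\int_{\mathbb{R}^n}\bar\Phi\big((M_vf)\,u^{-p_0}\big)\,v\,dx\le K_0\int_{\mathbb{R}^n}\bar\Phi\big(|f|\,u^{-p_0}\big)\,v\,dx\qquad\text{for all measurable } f.$$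
   Context: A weight on $\mathbb{R}^n$ is a measurable $w$ with $0<w<\infty$ a.e.; $w(E)=\int_E w\,dx$; $\|f\|_{L^p(w)}=(\int|f|^p w\,dx)^{1/p}$. The Hardy–Littlewood maximal operator is $Mf(x)=\sup_{Q\ni x}\frac1{|Q|}\int_Q|f|\,dy$ (sup over cubes $Q\ni x$); $w\in A_1$ if $[w]_{A_1}=\|Mw/w\|_{L^\infty}<\infty$. For a weight $v$, $M_vf(x)=\sup_{Q\ni x}\frac1{v(Q)}\int_Q|f|v\,dy$. A family of extrapolation pairs is a collection of pairs $(f,g)$ of nonnegative measurable functions on $\mathbb{R}^n$. A Young function is a continuous, convex, strictly increasing $\Phi:[0,\infty)\to[0,\infty)$ with $\Phi(t)/t\to0$ as $t\to0^+$ and $\Phi(t)/t\to\infty$ as $t\to\infty$; its complementary function is $\bar\Phi(t)=\sup_{s>0}\{st-\Phi(s)\}$. With $h_\Phi(t)=\sup_{s>0}\Phi(st)/\Phi(s)$, its dilation indices are $i_\Phi=\lim_{t\to0^+}\frac{\log h_\Phi(t)}{\log t}$ and $I_\Phi=\lim_{t\to\infty}\frac{\log h_\Phi(t)}{\log t}$. *)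

(* Defs.v *)
From HB Require Import structures.
From mathcomp Require Import all_boot all_order all_algebra.
From mathcomp Require Import all_classical all_reals all_analysis.
From mathcomp Require Import measurable_realfun ess_sup_inf.
Import Order.TTheory GRing.Theory Num.Theory.
Import numFieldNormedType.Exports.

Set Implicit Arguments.
Unset Strict Implicit.
Unset Printing Implicit Defensive.

Local Open Scope classical_set_scope.
Local Open Scope ring_scope.

Definition Rn_display : measure_display.
Proof. exact: default_measure_display. Qed.

Section euclidean_space.
Variable R : realType.
Let RB : measurableType _ := measurableTypeR R.

Definition snoc n (x : n.-tuple RB * RB) : n.+1.-tuple RB :=
  [tuple of x.2 :: x.1].

Lemma measurable_snoc n : measurable_fun [set: n.-tuple RB * RB] (@snoc n).
Proof. exact: measurable_cons. Qed.

Definition measure_snoc n (m : {measure set (n.-tuple RB) -> \bar R}) :=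
  pushforward (m \x @lebesgue_measure R)%E (@snoc n).

HB.instance Definition _ n (m : {measure set (n.-tuple RB) -> \bar R}) :=
  Measure.copy (measure_snoc m)
    (measure_function_pushforward__canonical__measure_function_Measure
      (m \x @lebesgue_measure R)%E (@measurable_snoc n)).

(* Lebesgue measure on the Borel sets of R^n, as an iterated product.  The
   empty product is the Dirac mass at the point of R^0. *)
Fixpoint borel_leb n : {measure set (n.-tuple RB) -> \bar R} :=
  match n with
  | 0 => \d_[tuple]
  | n.+1 => measure_snoc (borel_leb n)
  end.

Definition Rn n : Type := n.-tuple R.

HB.instance Definition _ n := Pointed.on (Rn n).

Definition leb_outer n : set (Rn n) -> \bar R := mu_ext (borel_leb n).

(* The sigma-algebra on Rn n consists of the Lebesgue measurable sets, that is,
   of the Caratheodory measurable sets of the outer measure of borel_leb n. *)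
Let cara n : measurableType _ := caratheodory_type (mu_ext (borel_leb n)).

HB.instance Definition _ n := @isMeasurable.Build Rn_display (Rn n)
  (caratheodory_measurable (@leb_outer n))
  (@measurable0 _ (cara n)) (@measurableC _ (cara n))
  (@bigcupT_measurable _ (cara n)).

Definition leb n : set (Rn n) -> \bar R := @leb_outer n.

HB.instance Definition _ n := @isMeasure.Build _ (Rn n) R (@leb n)
  (@measure0 _ (cara n) R (@completed_measure_extension _ _ R (borel_leb n)))
  (@measure_ge0 _ (cara n) R (@completed_measure_extension _ _ R (borel_leb n)))
  (@measure_semi_sigma_additive _ (cara n) R
    (@completed_measure_extension _ _ R (borel_leb n))).

End euclidean_space.
Arguments leb : clear implicits.

Section weights.
Variables (R : realType) (n : nat).
Local Open Scope ereal_scope.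
Local Notation T := (Rn R n).
Local Notation mu := (leb R n).
Implicit Types (f w v : T -> \bar R) (Q : set T).

Definition weight w := measurable_fun [set: T] w /\
  {ae mu, forall x, 0 < w x < +oo}.

Definition wmeas w (E : set T) : \bar R := \int[mu]_(x in E) w x.

Definition wnorm w (p : R) f : \bar R :=
  (\int[mu]_x (`|f x| `^ p * w x)) `^ p^-1.

(* Convention: cubes are open, with sides parallel to the axes.  Closed cubes
   give the same Mf, and the same M_v f when v is locally integrable. *)
Definition cube (a : T) (l : R) : set T :=
  [set x : T | forall i : 'I_n, (tnth a i < tnth x i < tnth a i + l)%R].

Definition cubes : set (set T) :=
  [set Q | exists (a : T) (l : R), (0 < l)%R /\ Q = cube a l].

Definition maximal f (x : T) : \bar R :=
  ereal_sup [set (mu Q)^-1 * \int[mu]_(y in Q) `|f y|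
            | Q in [set Q | cubes Q /\ Q x]].

Definition wmaximal v f (x : T) : \bar R :=
  ereal_sup [set (wmeas v Q)^-1 * \int[mu]_(y in Q) (`|f y| * v y)
            | Q in [set Q | cubes Q /\ Q x]].

Definition A1const w : \bar R :=
  Lnorm mu +oo (fun x => maximal w x / w x).

Definition A1 w := weight w /\ A1const w < +oo.

Definition extrapolation_family (F : set ((T -> \bar R) * (T -> \bar R))) :=
  forall f g, F (f, g) ->
    [/\ measurable_fun [set: T] f, (forall x, 0 <= f x),
        measurable_fun [set: T] g & (forall x, 0 <= g x)].

End weights.

Lemma measurable_borel_box (R : realType) n (a b : 'I_n -> R) :
  measurable [set x : n.-tuple (measurableTypeR R) | forall i, a i < tnth x i < b i].
Proof.
rewrite (_ : mkset _ = \big[setI/setT]_(i < n) ((@tnth n _ ^~ i) @^-1` (`]a i, b i[%classic : set (measurableTypeR R)))).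
    apply: bigsetI_measurable => i _; rewrite -[X in measurable X]setTI.
    exact: (@measurable_tnth _ (measurableTypeR R)).
  apply/seteqP; split => x /= h.
    by rewrite -bigcap_seq => i _ /=; rewrite in_itv/=; exact: h.
  move: h; rewrite -bigcap_seq => h i.
  by have := h i (mem_index_enum i); rewrite /= in_itv/=.
Qed.

Lemma borel_box (R : realType) n (a b : 'I_n -> R) (ab : forall i, a i <= b i) :
  let B := [set x : n.-tuple (measurableTypeR R) | forall i, a i < tnth x i < b i] in
  measurable B /\ borel_leb R n B = (\prod_(i < n) (b i - a i))%:E.
Proof.
move=> B; have mB := @measurable_borel_box R.
split; first exact: mB.
rewrite {}/B; elim: n a b ab => [|n IH] a b ab.
  by rewrite /= big_ord0 /dirac indicE mem_set// => -[].
rewrite big_ord_recl /= /measure_snoc /pushforward.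
rewrite (_ : _ @^-1` _ = [set x : n.-tuple (measurableTypeR R) | forall i, a (lift ord0 i) < tnth x i < b (lift ord0 i)] `*` (`]a ord0, b ord0[%classic : set (measurableTypeR R))).
  rewrite product_measure1E//=; last exact: mB.
  rewrite IH; last by move=> i; exact: ab.
  rewrite lebesgue_measure_itv/= lte_fin.
  have := ab ord0; rewrite le_eqVlt => /predU1P[->|h].
    by rewrite ltxx subrr mule0 mul0r.
  by rewrite h -EFinB -EFinM mulrC.
apply/seteqP; split => -[x t] /= h.
  split => [i|]; first by have := h (lift ord0 i); rewrite tnthS.
  by rewrite in_itv/=; exact: (h ord0).
move=> i; case: h => h1; rewrite in_itv/= => h2.
case: (unliftP ord0 i) => [j ->|->]; last exact: h2.
by rewrite tnthS.
Qed.

Lemma leb_cube (R : realType) n (a : Rn R n) (l : R) : 0 < l ->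
  measurable (cube a l) /\ leb R n (cube a l) = (l ^+ n)%:E.
Proof.
move=> l0.
have [|mB] := @borel_box R n (tnth a) (fun i => tnth a i + l).
  by move=> i; rewrite lerDl ltW.
rewrite (eq_bigr (fun=> l)); last by move=> i _; rewrite addrC addKr.
rewrite prodr_const card_ord => <-; split.
  exact: (@caratheodory_measurable_mu_ext _ R _ (borel_leb R n) _ mB).
exact: (measurable_mu_extE (borel_leb R n)).
Qed.

Section young.
Variable R : realType.
Implicit Types (Phi : R -> R) (t s : R).

(* Only the values of Phi on [0, +oo[ are relevant. *)
Record young Phi : Prop := Young {
  young_ge0 : forall t, 0 <= t -> 0 <= Phi t ;
  young_continuous : {within [set` `[0, +oo[], continuous Phi} ;
  young_convex : @convex_function R R^o [set` `[0, +oo[] Phi ;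
  young_increasing : {in `[0, +oo[ &, {homo Phi : s t / s < t}} ;
  young_cvg0 : Phi t / t @[t --> 0^'+] --> 0 ;
  young_cvgy : Phi t / t @[t --> +oo] --> +oo }.

Local Open Scope ereal_scope.

(* The supremum is also meaningful at t = +oo, where it is +oo; likewise
   er_map Phi extends Phi by er_map Phi +oo = +oo. *)
Definition complementary Phi (t : \bar R) : \bar R :=
  ereal_sup [set s%:E * t - (Phi s)%:E | s in [set s : R | (0 < s)%R]].

Definition dilation Phi t : \bar R :=
  ereal_sup [set (Phi (s * t) / Phi s)%:E | s in [set s : R | (0 < s)%R]].

Definition lower_index Phi : \bar R :=
  lim (lne (dilation Phi t) / (ln t)%:E @[t --> 0^'+]).

Definition upper_index Phi : \bar R :=
  lim (lne (dilation Phi t) / (ln t)%:E @[t --> +oo%R]).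

End young.

(* Main.v *)
Require Import Defs.
From HB Require Import structures.
From mathcomp Require Import all_boot all_order all_algebra.
From mathcomp Require Import all_classical all_reals all_analysis.
From mathcomp Require Import measurable_realfun ess_sup_inf.
From mathcomp Require Import ring lra.
Import Order.TTheory GRing.Theory Num.Theory.
Import numFieldNormedType.Exports.
Local Open Scope classical_set_scope.
Local Open Scope ereal_scope.

(** The proof is duality plus the Rubio de Francia algorithm, carried out with
    modulars instead of norms.  Write [F = f ^ p0 * u ^ p0], and let [Psi] be the
    complementary function of [Phi].  Since [Phi F = F * (Phi F / F)], the left-hand
    side is the integral of [f ^ p0 * h * v] with [h = (Phi F / F) * u ^ p0], and
    [Psi (Phi t / t) <= Phi t] bounds the integral of [Psi (h * u ^ - p0) * v] by the
    left-hand side itself.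

    The series [rdf h] of the iterates of [M_v] on [h], with geometric coefficients,
    satisfies [h <= 2 * rdf h] and [M_v (rdf h) <= 2 * K * rdf h], and convexity of
    [Psi] shows that its modular is at most that of [h] (lemma [rdf_modular]).  As
    [M (rdf h * v) <= M v * M_v (rdf h)] and [v] is in [A1], the function [rdf h * v]
    is an [A1] weight, with a bound on its constant that depends only on [K] and [v]
    (lemma [A1_rdf]).
    The hypothesis for this weight replaces [f] by [g]; Young's inequality then
    splits off half of the modular of [rdf h], which is absorbed on the left, and a
    multiple of the integral of [Phi (g ^ p0 * u ^ p0) * v], because a finite upper
    index makes [Phi] doubling (lemma [young_doubling]).  Absorption requires a finite
    left-hand side: the argument runs on truncations of [F] ([extrapolation_finite]),
    and monotone convergence gives the general case ([modular_extrapolation]).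

    One point is specific to the form of the hypothesis: the constant
    is an arbitrary function of the [A1] constant, so that bounding the
    constants of the weights [rdf h * v] uniformly is not sufficient.  They
    are made equal.  Lemma [A1const_prescribed] changes an [A1] weight by a bounded
    factor so that its constant becomes any given number that is at least [1] and at
    least the original bound: the weight is multiplied by [s <= 1] on a small set,
    and the constant is followed as [s] decreases. *)

Set Implicit Arguments.
Unset Strict Implicit.

(** * Cubes and the measurability of maximal functions *)

Section cubes.
Variables (R : realType) (n : nat).
Local Notation T := (Rn R n).
Local Notation mu := (leb R n).

Lemma cubes_measurable (Q : set T) : cubes Q -> measurable Q.
Proof. by move=> [a [l [l0 ->]]]; have [] := leb_cube a l0. Qed.

Lemma cubes_leb_gt0 (Q : set T) : cubes Q -> 0 < mu Q.
Proof.
move=> [a [l [l0 ->]]]; have [_ ->] := leb_cube a l0.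
by rewrite lte_fin exprn_gt0.
Qed.

Lemma cubes_leb_fin (Q : set T) : cubes Q -> mu Q \is a fin_num.
Proof. by move=> [a [l [l0 ->]]]; have [_ ->] := leb_cube a l0. Qed.

Lemma leb_setT_gt0 : 0 < mu [set: T].
Proof.
have cQ : cubes (cube [tuple 0%R | i < n] (1 : R)) by exists [tuple 0%R | i < n], 1%R.
apply: (lt_le_trans (cubes_leb_gt0 cQ)).
by apply: le_measure; rewrite ?inE; [exact: cubes_measurable| |].
Qed.

Lemma ae_exists (A : set T) (P : T -> Prop) : measurable A -> 0 < mu A ->
  {ae mu, forall x, P x} -> exists2 x, A x & P x.
Proof.
move=> mA A0 [N [mN N0 PN]]; apply: contrapT => h.
suff : mu A <= mu N by rewrite N0 leNgt A0.
apply: le_measure; rewrite ?inE// => x Ax; apply: PN => /= Px.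
by apply: h; exists x.
Qed.

(** Subcubes with rational corner and side reduce an arbitrary union of cubes to
    a countable one. *)
Lemma rational_cube (a x : T) (l : R) : cube a l x ->
  exists q : n.-tuple rat * rat,
    [/\ (0 < ratr q.2 :> R)%R, cube [tuple ratr (tnth q.1 i) | i < n] (ratr q.2) x
      & cube [tuple ratr (tnth q.1 i) | i < n] (ratr q.2) `<=` cube a l].
Proof.
move=> xal.
pose d i := Num.min (tnth x i - tnth a i)%R (tnth a i + l - tnth x i)%R.
have d0 i : (0 < d i)%R.
  by rewrite lt_min !subr_gt0; have /andP[-> ->] := xal i.
have [e e0 ed] : exists2 e : R, (0 < e)%R & forall i, (e <= d i)%R.
  exists (\big[Num.min/1%R]_(i < n) d i); last by move=> i; exact: bigmin_le_cond.
  by apply: lt_bigmin.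
have [r /andP[r0 re]] : exists q : rat, (0 < ratr q :> R)%R && (ratr q < e)%R.
  have [q] := rat_in_itvoo e0; rewrite in_itv/= => qe.
  by exists q.
have h i : {q : rat | (tnth x i - ratr r < ratr q < tnth x i)%R}.
  have lt1 : (tnth x i - ratr r < tnth x i)%R by rewrite ltrBlDr ltrDl.
  by apply: cid; have [q] := rat_in_itvoo lt1; rewrite in_itv/=; exists q.
exists ([tuple sval (h i) | i < n], r); split => //= [i|y yq i].
  rewrite !tnth_mktuple; case: (h i) => q /= /andP[q1 q2].
  by rewrite q2/= -ltrBlDr.
have := yq i; rewrite !tnth_mktuple; case: (h i) => q /= /andP[q1 q2] /andP[y1 y2].
have := ed i; rewrite le_min => /andP[ed1 ed2]; apply/andP; split.
  rewrite (le_lt_trans _ y1)// (le_trans _ (ltW q1))//.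
  by rewrite lerBrDr -lerBrDl (le_trans (ltW re)).
rewrite (lt_le_trans y2)// (le_trans (lerD (ltW q2) (ltW re)))//.
by rewrite -lerBrDl.
Qed.

Lemma measurable_bigcup_cubes (S : set (set T)) : S `<=` @cubes R n ->
  measurable (\bigcup_(Q in S) Q).
Proof.
move=> Sc.
pose rcube (q : n.-tuple rat * rat) : set T :=
  cube [tuple ratr (tnth q.1 i) | i < n] (ratr q.2).
rewrite (_ : \bigcup_(Q in S) Q = \bigcup_(q in
    [set q | (0 < ratr q.2 :> R)%R /\ rcube q `<=` \bigcup_(Q in S) Q]) rcube q).
  rewrite bigcup_mkcond; apply: countable_bigcupT_measurable => // q.
  case: ifPn => [/set_mem[q0 _]|_]; last exact: measurable0.
  apply: cubes_measurable.
  by exists [tuple ratr (tnth q.1 i) | i < n], (ratr q.2).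
apply/seteqP; split => [x [Q SQ Qx]|x [q [_ +] qx]]; last exact.
have [a [l [l0 Qal]]] := Sc _ SQ.
have [q [q0 qx qal]] : exists q : n.-tuple rat * rat,
  [/\ (0 < ratr q.2 :> R)%R, rcube q x & rcube q `<=` cube a l].
  by apply: rational_cube; rewrite -Qal.
exists q => //; split => // y /qal qy; exists Q => //.
by rewrite Qal.
Qed.

(** The superlevel sets are unions of cubes. *)
Lemma measurable_cubes_sup (a : set T -> \bar R) :
  measurable_fun [set: T]
    (fun x => ereal_sup [set a Q | Q in [set Q | cubes Q /\ Q x]]).
Proof.
move=> mT; apply: (measurability _ (ErealGenOInfty.measurableE R)) => //.
move=> _ [_ [r ->] <-]; rewrite setTI.
rewrite (_ : _ @^-1` _ = \bigcup_(Q in [set Q | cubes Q /\ r%:E < a Q]) Q).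
  by apply: measurable_bigcup_cubes => Q [].
apply/seteqP; split => x /=; rewrite in_itv/= andbT.
  by move=> /ereal_sup_gt[_ [Q [cQ Qx] <-] rQ]; exists Q.
  by move=> [Q [cQ rQ] Qx]; apply: (lt_le_trans rQ); apply: ereal_sup_ubound; exists Q.
Qed.

Lemma measurable_wmaximal (v f : T -> \bar R) :
  measurable_fun [set: T] (wmaximal v f).
Proof. exact: measurable_cubes_sup. Qed.

End cubes.

(** * Inequalities for maximal operators *)

Section maximal_operators.
Variables (R : realType) (n : nat).
Local Notation T := (Rn R n).
Local Notation mu := (leb R n).
Implicit Types (f w : T -> \bar R) (v : T -> R).

Lemma integral_gt0 (A : set T) f : measurable A -> 0 < mu A ->
  measurable_fun A f -> (forall x, A x -> 0 < f x) -> 0 < \int[mu]_(x in A) f x.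
Proof.
move=> mA A0 mf f0; rewrite lt0e integral_ge0 ?andbT; last first.
  by move=> x /f0/ltW.
apply/eqP => f_eq0.
have /(ae_eq_integral_abs mu mA mf) : \int[mu]_(x in A) `|f x| = 0.
  by rewrite -[RHS]f_eq0; apply: eq_integral => x /set_mem/f0/ltW/gee0_abs.
by move=> /(ae_exists mA A0)[x Ax /(_ Ax)] fx; have := f0 _ Ax; rewrite fx ltxx.
Qed.

Lemma integral_cubes_le_wmaximal v f x (Q : set T) :
  0 < wmeas (EFin \o v) Q < +oo -> cubes Q -> Q x ->
  \int[mu]_(y in Q) (`|f y| * (v y)%:E)
    <= wmeas (EFin \o v) Q * wmaximal (EFin \o v) f x.
Proof.
move=> /andP[v0 vy] cQ Qx.
have vfin : wmeas (EFin \o v) Q \is a fin_num by rewrite ge0_fin_numE ?ltW.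
rewrite -[leLHS]mul1e -(mulVe (negbT (gt_eqF v0)) vfin) muleAC muleC.
apply: lee_wpmul2l; first exact: ltW.
by apply: ereal_sup_ubound; exists Q.
Qed.

Lemma wmaximal_le v f x c :
  (forall Q, cubes Q -> Q x -> 0 < wmeas (EFin \o v) Q < +oo /\
    \int[mu]_(y in Q) (`|f y| * (v y)%:E) <= wmeas (EFin \o v) Q * c) ->
  wmaximal (EFin \o v) f x <= c.
Proof.
move=> h; apply: ge_ereal_sup => _ [Q [cQ Qx] <-].
have [/andP[v0 vy] fc] := h _ cQ Qx.
have vfin : wmeas (EFin \o v) Q \is a fin_num by rewrite ge0_fin_numE ?ltW.
rewrite -[leRHS]mul1e -(mulVe (negbT (gt_eqF v0)) vfin) -muleA.
by apply: lee_wpmul2l => //; rewrite inve_ge0 ltW.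
Qed.

Lemma maximalE f : maximal f = wmaximal (EFin \o cst 1%R) f.
Proof.
apply/funext => x; congr ereal_sup; apply: eq_imagel => Q [cQ _] /=.
rewrite /wmeas /= integral_cst ?mul1e; last exact: cubes_measurable.
by congr (_ * _); apply: eq_integral => y _; rewrite mule1.
Qed.

Lemma wmaximal_ge0 v f x : (forall x, 0 < v x)%R -> 0 <= wmaximal (EFin \o v) f x.
Proof.
move=> v0.
pose a : T := [tuple (tnth x i - 2^-1)%R | i < n].
have cQ : cubes (cube a 1) by exists a, 1%R.
have Qx : cube a 1 x.
  by move=> i; rewrite tnth_mktuple; lra.
apply: (@le_trans _ _ ((wmeas (EFin \o v) (cube a 1))^-1 *
   \int[mu]_(y in cube a 1) (`|f y| * (EFin \o v) y))).
  rewrite mule_ge0// ?inve_ge0; apply: integral_ge0 => y _ /=.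
    by rewrite lee_fin ltW.
  by rewrite mule_ge0// lee_fin ltW.
by apply: ereal_sup_ubound; exists (cube a 1).
Qed.

Lemma le_wmaximal v f g x : (forall x, 0 < v x)%R -> measurable_fun [set: T] v ->
  measurable_fun [set: T] f -> measurable_fun [set: T] g ->
  (forall y, `|f y| <= `|g y|) ->
  wmaximal (EFin \o v) f x <= wmaximal (EFin \o v) g x.
Proof.
move=> v0 mv mf mg fg; apply: ge_ereal_sup => _ [Q [cQ Qx] <-].
apply: (@le_trans _ _ ((wmeas (EFin \o v) Q)^-1 *
   \int[mu]_(y in Q) (`|g y| * (EFin \o v) y))); last first.
  by apply: ereal_sup_ubound; exists Q.
apply: lee_wpmul2l.
  by rewrite inve_ge0; apply: integral_ge0 => y _; rewrite /= lee_fin ltW.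
have mQ := cubes_measurable cQ.
have mV : measurable_fun Q (EFin \o v).
  by apply/measurable_EFinP; exact: measurable_funTS.
apply: (ge0_le_integral _ mQ).
- by move=> y _; rewrite mule_ge0//= lee_fin ltW.
- apply: emeasurable_funM mV; exact/measurableT_comp/measurable_funTS.
- apply: emeasurable_funM mV; exact/measurableT_comp/measurable_funTS.
- by move=> y _; rewrite lee_wpmul2r//= lee_fin ltW.
Qed.

Lemma wmaximalZ_le v f x (c : R) : (forall x, 0 < v x)%R ->
  measurable_fun [set: T] v -> measurable_fun [set: T] f -> (0 <= c)%R ->
  wmaximal (EFin \o v) (fun y => c%:E * f y) x <= c%:E * wmaximal (EFin \o v) f x.
Proof.
move=> v0 mv mf c0; apply: ge_ereal_sup => _ [Q [cQ Qx] <-].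
have mQ := cubes_measurable cQ.
rewrite (eq_integral (fun y => c%:E * (`|f y| * (v y)%:E))); last first.
  by move=> y _ /=; rewrite abseM gee0_abs// muleA.
rewrite (ge0_integralZl_EFin _ mQ _ _ c0); last 2 first.
- by move=> y _; rewrite mule_ge0// lee_fin ltW.
- apply: emeasurable_funM; first exact/measurableT_comp/measurable_funTS.
  by apply/measurable_EFinP; exact: measurable_funTS.
rewrite muleCA; apply: lee_wpmul2l => //.
by apply: ereal_sup_ubound; exists Q.
Qed.

Lemma wmaximal_nneseries v (f : nat -> T -> \bar R) x :
  (forall x, 0 < v x)%R -> measurable_fun [set: T] v ->
  (forall Q : set T, cubes Q -> 0 < wmeas (EFin \o v) Q < +oo) ->
  (forall k, measurable_fun [set: T] (f k)) -> (forall k x, 0 <= f k x) ->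
  wmaximal (EFin \o v) (fun y => \sum_(k <oo) f k y) x
    <= \sum_(k <oo) wmaximal (EFin \o v) (f k) x.
Proof.
move=> v0 mv vQ mf f0; apply: wmaximal_le => Q cQ Qx; split; first exact: vQ.
have mQ := cubes_measurable cQ.
have mfk k : measurable_fun Q (f k) by exact: measurable_funTS.
rewrite (eq_integral (fun y => \sum_(k <oo) (`|f k y| * (v y)%:E))); last first.
  move=> y _ /=; rewrite gee0_abs; last by apply: nneseries_ge0 => k _ _.
  rewrite muleC -nneseriesZl//; apply: eq_eseriesr => k _.
  by rewrite muleC gee0_abs.
rewrite (integral_nneseries _ mQ); last 2 first.
- move=> k; apply: emeasurable_funM; first exact: measurableT_comp.
  by apply/measurable_EFinP; exact: measurable_funTS.
- by move=> k y _; rewrite mule_ge0// lee_fin ltW.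
have /andP[vQ0 vQy] := vQ _ cQ.
rewrite -(fineK (_ : wmeas (EFin \o v) Q \is a fin_num)); last first.
  by rewrite ge0_fin_numE// ltW.
rewrite -nneseriesZl; last by move=> k _; exact: wmaximal_ge0.
apply: lee_nneseries => k _.
  by move=> _; apply: integral_ge0 => y _; rewrite mule_ge0// lee_fin ltW.
rewrite fineK; last by rewrite ge0_fin_numE// ltW.
by apply: integral_cubes_le_wmaximal => //; rewrite vQ0.
Qed.

(** An unweighted average of [f * v] is the product of a [v]-average of [f] and an
    average of [v]. *)
Lemma maximalM v f x : measurable_fun [set: T] v ->
  (forall x, 0 < v x)%R ->
  (forall Q : set T, cubes Q -> 0 < wmeas (EFin \o v) Q < +oo) ->
  maximal (fun y => f y * (v y)%:E) x
    <= maximal (EFin \o v) x * wmaximal (EFin \o v) f x.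
Proof.
move=> mv v0 vQ; apply: ge_ereal_sup => _ [Q [cQ Qx] <-].
rewrite (eq_integral (fun y => `|f y| * (v y)%:E)); last first.
  by move=> y _; rewrite abseM [X in _ * X]gee0_abs// lee_fin ltW.
apply: (@le_trans _ _ ((mu Q)^-1 *
    (wmeas (EFin \o v) Q * wmaximal (EFin \o v) f x))).
  apply: lee_wpmul2l; first by rewrite inve_ge0 ltW// cubes_leb_gt0.
  exact: integral_cubes_le_wmaximal (vQ _ cQ) _ _.
rewrite muleA; apply: lee_wpmul2r; first exact: wmaximal_ge0.
apply: ereal_sup_ubound; exists Q => //; congr (_ * _).
by apply: eq_integral => y _; rewrite /= gtr0_norm.
Qed.

End maximal_operators.

(** * The constant of an A1 weight *)

(** Monotonicity of [s * phi s] rules out downward jumps of [phi], which is the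
    only obstruction to crossing the level [a] downwards: the value [a] is taken at
    the supremum of the points where [phi] is at least [a]. *)
Lemma IVT_no_downward_jump (R : realType) (phi : R -> R) (k a : R) :
  (0 < k <= 1)%R -> (0 < a)%R ->
  (forall s t, k <= s -> s <= t -> t <= 1 -> s * phi s <= t * phi t)%R ->
  (phi 1 <= a <= phi k)%R -> exists2 s, (k <= s <= 1)%R & phi s = a.
Proof.
move=> /andP[k0 k1] a0 phi_nd /andP[phi1 phik].
pose S := [set s | (k <= s <= 1)%R /\ (a <= phi s)%R].
have Sk : S k by split => //; rewrite lexx.
have S1 : ubound S 1%R by move=> s [/andP[_ ?] _].
have supS : has_sup S by split; [exists k|exists 1%R].
have ks : (k <= sup S)%R by exact: (sup_upper_bound supS).
have s1 : (sup S <= 1)%R by apply: ge_sup => //; exists k.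
have s0 : (0 < sup S)%R by exact: lt_le_trans ks.
exists (sup S); first by rewrite ks s1.
apply/eqP; rewrite eq_le; apply/andP; split; last first.
  suff : (sup S <= sup S * phi (sup S) / a)%R.
    by rewrite ler_pdivlMr// ler_pM2l.
  apply: ge_sup; first by exists k.
  move=> s [/andP[k_s s_1] as_]; rewrite ler_pdivlMr//.
  have sS : (s <= sup S)%R by apply: (sup_upper_bound supS); split => //; rewrite k_s.
  rewrite (le_trans _ (phi_nd _ _ k_s sS s1))// ler_wpM2l//.
  by rewrite ltW// (lt_le_trans k0).
rewrite leNgt; apply/negP => aphi.
have s_lt1 : (sup S < 1)%R.
  rewrite lt_neqAle s1 andbT; apply/eqP => e.
  by move: aphi; rewrite e ltNge phi1.
pose t := Num.min 1%R (sup S * phi (sup S) / a)%R.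
have st : (sup S < t)%R by rewrite lt_min s_lt1 ltr_pdivlMr// ltr_pM2l.
have t1 : (t <= 1)%R by rewrite ge_min lexx.
have kt : (k <= t)%R by rewrite (le_trans ks)// ltW.
have ta : (t * a <= sup S * phi (sup S))%R.
  by rewrite -ler_pdivlMr// ge_min lexx orbT.
have := le_trans ta (phi_nd _ _ ks (ltW st) t1).
rewrite ler_pM2l ?(lt_trans s0)// => aphit.
have : S t by split => //; rewrite kt.
by move=> /(sup_upper_bound supS); rewrite leNgt st.
Qed.

Section A1_weights.
Variables (R : realType) (n : nat).
Local Notation T := (Rn R n).
Local Notation mu := (leb R n).
Implicit Types (w : T -> R).

Lemma A1const_leP w (c : R) : (forall x, 0 < w x)%R ->
  A1const (EFin \o w) <= c%:E <->
  {ae mu, forall x, maximal (EFin \o w) x <= (c * w x)%:E}.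
Proof.
move=> w0; rewrite /A1const unlock /= leb_setT_gt0.
have eq_le x : (`|maximal (EFin \o w) x / (w x)%:E| <= c%:E) =
    (maximal (EFin \o w) x <= (c * w x)%:E).
  have M0 : 0 <= maximal (EFin \o w) x by rewrite maximalE; exact: wmaximal_ge0.
  rewrite inver gt_eqF// gee0_abs ?lee_pdivrMr ?EFinM//.
  by rewrite mule_ge0// lee_fin invr_ge0 ltW.
split => [/ess_supP|h]; first by apply: filterS => x /=; rewrite eq_le.
by apply/ess_supP; apply: filterS h => x; rewrite -eq_le.
Qed.

(** The maximal function is finite almost everywhere, hence at some point of
    each cube, and its value there bounds the average over the cube. *)
Lemma A1_cubes w (c : R) : (forall x, 0 < w x)%R -> measurable_fun [set: T] w ->
  A1const (EFin \o w) <= c%:E ->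
  forall Q : set T, cubes Q -> 0 < wmeas (EFin \o w) Q < +oo.
Proof.
move=> w0 mw /(A1const_leP _ w0) wc Q cQ.
have mQ := cubes_measurable cQ; have Q0 := cubes_leb_gt0 cQ.
have mwQ : measurable_fun Q (EFin \o w).
  by apply/measurable_EFinP; exact: measurable_funTS.
rewrite /wmeas (integral_gt0 mQ Q0 mwQ)/=; last by move=> x _; rewrite lte_fin.
have [x Qx Mx] := ae_exists mQ Q0 wc.
have := integral_cubes_le_wmaximal (v := cst 1%R) (EFin \o w) _ cQ Qx.
rewrite -maximalE /wmeas /= integral_cst// mul1e Q0 ltey_eq cubes_leb_fin//.
move=> /(_ isT) h.
rewrite (eq_integral (fun y => `|(w y)%:E| * 1)); last first.
  by move=> y _; rewrite mule1 gee0_abs// lee_fin ltW.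
apply: (le_lt_trans h); rewrite lte_mul_pinfty ?ltW ?cubes_leb_fin//.
exact: (le_lt_trans Mx (ltry _)).
Qed.

Lemma le_maximal w w' x : (forall x, 0 < w x)%R ->
  measurable_fun [set: T] w -> measurable_fun [set: T] w' ->
  (forall y, w y <= w' y)%R ->
  maximal (EFin \o w) x <= maximal (EFin \o w') x.
Proof.
move=> w0 mw mw' ww'; rewrite !maximalE; apply: le_wmaximal.
- by move=> y; exact: ltr01.
- exact: measurable_cst.
- exact/measurable_EFinP.
- exact/measurable_EFinP.
- move=> y /=; by rewrite lee_fin gtr0_norm// gtr0_norm ?ww'// (lt_le_trans (w0 y)).
Qed.

Lemma A1const_le_comparable w w' (k a : R) :
  (forall x, 0 < w x)%R -> (forall x, 0 < w' x)%R ->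
  measurable_fun [set: T] w -> measurable_fun [set: T] w' ->
  (forall x, w x <= w' x <= k * w x)%R -> (0 <= a)%R ->
  A1const (EFin \o w') <= a%:E -> A1const (EFin \o w) <= (k * a)%:E.
Proof.
move=> w0 w'0 mw mw' ww' a0 /(A1const_leP _ w'0) h; apply/A1const_leP => //.
apply: filterS h => x h; have /andP[_ w'kw] := ww' x.
apply: (le_trans (le_maximal x w0 mw mw' _)) => [y|].
  by have /andP[] := ww' y.
by rewrite (le_trans h)// lee_fin -mulrA mulrCA ler_wpM2l.
Qed.


(** Two subcubes of half the side at opposite corners are disjoint, so one of
    them carries at most half of the mass. *)
Lemma light_subcube w : (0 < n)%N ->
  (forall x, 0 < w x)%R -> measurable_fun [set: T] w ->
  exists Q Q' : set T, [/\ cubes Q, cubes Q', Q' `<=` Q,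
    mu Q = (2 ^+ n)%:E * mu Q'
    & wmeas (EFin \o w) Q' + wmeas (EFin \o w) Q' <= wmeas (EFin \o w) Q].
Proof.
move=> n_gt0 w0 mw.
pose o : T := [tuple 0%R | i < n]; pose e : T := [tuple 1%R | i < n].
have leb2 a : leb R n (cube o 2) = (2 ^+ n)%:E * leb R n (cube a 1).
  have [_ ->] := @leb_cube R n o 2 ltac:(lra).
  by have [_ ->] := @leb_cube R n a 1 ltr01; rewrite expr1n mule1.
have co : cubes (cube o (1 : R)) by exists o, 1%R.
have ce : cubes (cube e (1 : R)) by exists e, 1%R.
have c2 : cubes (cube o (2 : R)) by exists o, 2%R; split => //; lra.
have so : cube o (1 : R) `<=` cube o 2.
  by move=> x xo i; have := xo i; rewrite tnth_mktuple; lra.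
have se : cube e (1 : R) `<=` cube o 2.
  by move=> x xe i; have := xe i; rewrite !tnth_mktuple; lra.
have oe : [disjoint cube o (1 : R) & cube e 1].
  apply/disj_set2P; rewrite -subset0 => x [xo xe].
  have := xo (Ordinal n_gt0); have := xe (Ordinal n_gt0).
  by rewrite !tnth_mktuple; lra.
have [mo me m2] : [/\ measurable (cube o (1 : R)), measurable (cube e (1 : R))
    & measurable (cube o (2 : R))] by split; exact: cubes_measurable.
have mwA (A : set T) : measurable_fun A (EFin \o w).
  by apply/measurable_EFinP; exact: measurable_funTS.
have le2 : wmeas (EFin \o w) (cube o 1) + wmeas (EFin \o w) (cube e 1)
    <= wmeas (EFin \o w) (cube o 2).
  rewrite /wmeas -(ge0_integral_setU _ mo me (mwA _) _ oe); last first.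
    by move=> x _; rewrite lee_fin ltW.
  apply: (ge0_subset_integral _ (measurableU _ _ mo me) m2 (mwA _)).
    by move=> x _; rewrite lee_fin ltW.
  by rewrite subUset.
have [wo|we] := leP (wmeas (EFin \o w) (cube o 1)) (wmeas (EFin \o w) (cube e 1)).
  exists (cube o 2), (cube o 1); split => //.
  by rewrite (le_trans _ le2)// leeD2l.
exists (cube o 2), (cube e 1); split => //.
by rewrite (le_trans _ le2)// leeD2r// ltW.
Qed.

End A1_weights.

(** * Prescribing the constant of an A1 weight *)

Section A1_prescribed.
Variables (R : realType) (n : nat).
Local Notation T := (Rn R n).
Local Notation mu := (leb R n).
Implicit Types (w : T -> R).

(** The set [A] consists of the points of a light subcube of [Q] where [w] is at
    most [2 ^+ n] times its average over [Q].  It is not negligible, since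
    otherwise the subcube would carry the whole mass of [Q]; and at least half of
    that mass remains outside [A], so that the average of [w] off [A] still
    dominates the values of [w] on [A].  Making [w] small on [A] therefore makes
    its constant large. *)
Lemma A1_heavy_spot w (c : R) : (0 < n)%N ->
  (forall x, 0 < w x)%R -> measurable_fun [set: T] w ->
  A1const (EFin \o w) <= c%:E ->
  exists A : set T, [/\ measurable A, 0 < mu A & forall x, A x ->
    (w x)%:E <= (2 ^+ n.+1)%:E * maximal (fun y => (w y)%:E * (\1_(~` A) y)%:E) x].
Proof.
move=> n_gt0 w0 mw wc.
have [Q [Q' [cQ cQ' Q'Q muQ wQ']]] := light_subcube n_gt0 w0 mw.
have [mQ mQ'] := (cubes_measurable cQ, cubes_measurable cQ').
have /andP[wQ0 wQy] := A1_cubes w0 mw wc cQ.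
have /andP[wQ'0 wQ'y] := A1_cubes w0 mw wc cQ'.
have [muQ0 muQfin] := (cubes_leb_gt0 cQ, cubes_leb_fin cQ).
have [muQ'0 muQ'fin] := (cubes_leb_gt0 cQ', cubes_leb_fin cQ').
pose q := fine (mu Q); pose q' := fine (mu Q').
pose m := fine (wmeas (EFin \o w) Q); pose m' := fine (wmeas (EFin \o w) Q').
have qE : mu Q = q%:E by rewrite fineK.
have q'E : mu Q' = q'%:E by rewrite fineK.
have mE : wmeas (EFin \o w) Q = m%:E by rewrite fineK// ge0_fin_numE// ltW.
have m'E : wmeas (EFin \o w) Q' = m'%:E by rewrite fineK// ge0_fin_numE// ltW.
have mwA (A : set T) : measurable_fun A (EFin \o w).
  by apply/measurable_EFinP; exact: measurable_funTS.
have wge0 (A : set T) x : A x -> 0 <= (EFin \o w) x.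
  by move=> _; rewrite lee_fin ltW.
have [q0 q'0 m0 m'0] : [/\ 0 < q, 0 < q', 0 < m & 0 < m']%R.
  by rewrite -!lte_fin -qE -q'E -mE -m'E.
have qq' : (q = 2 ^+ n * q')%R by apply: EFin_inj; rewrite EFinM -qE -q'E.
have mm' : (m' + m' <= m)%R by rewrite -lee_fin EFinD -m'E -mE.
pose r : R := (2 ^+ n * (m / q))%R.
have rq' : (r * q' = m)%R.
  by rewrite /r qq'; field; rewrite gt_eqF//= expf_neq0.
pose A := Q' `&` [set x | (w x <= r)%R].
have mA : measurable A.
  exact: measurable_fun_le mQ' (measurable_funTS mw) (measurable_cst _).
have AQ : A `<=` Q by move=> x [/Q'Q].
have A0 : 0 < mu A.
  rewrite lt0e measure_ge0 andbT; apply/eqP => A0.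
  have : \int[mu]_(x in Q') (cst r%:E) x <= \int[mu]_(x in Q') (EFin \o w) x.
    apply: (ae_ge0_le_integral mQ').
    - by move=> x _; rewrite lee_fin mulr_ge0// ?exprn_ge0// divr_ge0// ltW.
    - exact: measurable_cst.
    - exact: wge0.
    - exact: mwA.
    - exists A; split => // x /=; apply: contra_notP => /not_andP[//|] + Q'x.
      by move=> /negP; rewrite -ltNge lee_fin => /ltW.
  have -> : \int[mu]_(x in Q') (cst r%:E) x = r%:E * mu Q' by exact: integral_cst.
  by rewrite -[leRHS]/(wmeas _ _) m'E q'E lee_fin rq'; lra.
exists A; split => // x Ax.
have mAC : measurable (Q `\` A) by exact: measurableD.
have split_Q : m%:E = \int[mu]_(y in A) (EFin \o w) y
    + \int[mu]_(y in Q `\` A) (EFin \o w) y.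
  rewrite -(ge0_integral_setU _ mA mAC (mwA _) (@wge0 _)); last first.
    by rewrite disj_set2E setDE setICA setICr setI0.
  by rewrite setDUK.
have leA : \int[mu]_(y in A) (EFin \o w) y <= m'%:E.
  rewrite -m'E; apply: (ge0_subset_integral _ mA mQ' (mwA _) (@wge0 _)).
  exact: subIsetl.
have leAC : (m / 2)%:E <= \int[mu]_(y in Q `\` A) (EFin \o w) y.
  rewrite leNgt; apply/negP => lt_m.
  have /le_lt_trans : m%:E <= m'%:E + \int[mu]_(y in Q `\` A) (EFin \o w) y.
    by rewrite split_Q leeD2r.
  move=> /(_ (m' + m / 2)%:E); rewrite EFinD lteD2lE// => /(_ lt_m).
  by rewrite -EFinD lte_fin; lra.
have Max : (q^-1)%:E * (m / 2)%:E
    <= maximal (fun y => (w y)%:E * (\1_(~` A) y)%:E) x.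
  apply: (@le_trans _ _ ((mu Q)^-1 *
      \int[mu]_(y in Q) `|(w y)%:E * (\1_(~` A) y)%:E|)); last first.
    by apply: ereal_sup_ubound; exists Q => //; split => //; exact: AQ.
  rewrite qE inver gt_eqF//; apply: lee_wpmul2l.
    by rewrite lee_fin invr_ge0 ltW.
  apply: (le_trans leAC).
  rewrite (eq_integral (fun y => `|(w y)%:E * (\1_(~` A) y)%:E|)); last first.
    move=> y /set_mem[_ Ay] /=.
    by rewrite indicE mem_set//= mulr1 gtr0_norm.
  apply: (ge0_subset_integral _ mAC mQ); last 2 first.
  - by move=> y _.
  - exact: subDsetl.
  apply: measurableT_comp; first exact: abse_measurable.
  apply: (emeasurable_funM (mwA _)).
  apply/measurable_EFinP; apply: measurable_indic; exact: measurableC.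
apply: le_trans (lee_wpmul2l _ Max); last by rewrite lee_fin exprn_ge0.
rewrite -!EFinM lee_fin; have [_ /le_trans] := Ax; apply.
by rewrite /r exprS le_eqVlt; apply/orP; left; apply/eqP; field; rewrite gt_eqF.
Qed.

(** Multiply [w] by [s <= 1] on the set given by [A1_heavy_spot].  Weights with
    parameters [s <= t] have a ratio between [1] and [t / s], so [s] times the
    constant is nondecreasing in [s]; the constant is at most [a] for [s = 1] and at
    least [a] for [s = (2 ^+ n.+1 * a)^-1]. *)
Lemma A1const_prescribed w (c a : R) : (0 < n)%N ->
  (forall x, 0 < w x)%R -> measurable_fun [set: T] w ->
  A1const (EFin \o w) <= c%:E -> (c <= a)%R -> (1 <= a)%R ->
  exists w' : T -> R, [/\ measurable_fun [set: T] w', forall x, (0 < w' x)%R,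
    forall x, (w' x <= w x <= 2 ^+ n.+1 * a * w' x)%R
    & A1const (EFin \o w') = a%:E].
Proof.
move=> n_gt0 w0 mw wc ca a1.
have [A [mA A0 Aw]] := A1_heavy_spot n_gt0 w0 mw wc.
have a0 : (0 < a)%R by exact: lt_le_trans a1.
pose D : R := (2 ^+ n.+1 * a)%R.
have D1 : (1 <= D)%R by rewrite mulr_ege1// exprn_ege1// ler1n.
have D0 : (0 < D)%R by exact: lt_le_trans D1.
have Dn0 : (D != 0)%R by rewrite gt_eqF.
pose W (s : R) (x : T) : R := ((\1_(~` A) x + s * \1_A x) * w x)%R.
have WE s x : W s x = (if x \in A then s * w x else w x)%R.
  rewrite /W !indicE in_setC; case: (x \in A) => /=.
    by rewrite add0r mulr1.
  by rewrite mulr0 addr0 mul1r.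
have mW s : measurable_fun [set: T] (W s).
  apply: measurable_funM mw; apply: measurable_funD.
    by apply: measurable_indic; exact: measurableC.
  by apply: measurable_funM; [exact: measurable_cst|exact: measurable_indic].
have W0 (s : R) x : (0 < s)%R -> (0 < W s x)%R.
  by move=> s0; rewrite WE; case: ifP => // _; rewrite mulr_gt0.
have W1 : W 1%R = w by apply/funext => x; rewrite WE mul1r if_same.
have W_comparable (s t : R) x : (0 < s)%R -> (s <= t)%R ->
    (W s x <= W t x <= t / s * W s x)%R.
  move=> s0 st; rewrite !WE; case: ifP => _.
    by rewrite ler_wpM2r ?(ltW (w0 x))//= mulrA divfK ?gt_eqF// lexx.
  by rewrite lexx/= ler_peMl ?(ltW (w0 x))// ler_pdivlMr// mul1r.
have A1const_W (s t b : R) : (0 < s)%R -> (s <= t)%R -> (0 <= b)%R ->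
    A1const (EFin \o W t) <= b%:E -> A1const (EFin \o W s) <= (t / s * b)%:E.
  move=> s0 st b0; apply: A1const_le_comparable => //.
  - by move=> x; exact: W0.
  - by move=> x; apply: W0; exact: lt_le_trans st.
  - by move=> x; exact: W_comparable.
have k01 : (0 < D^-1 <= 1)%R by rewrite invr_gt0 D0 invf_le1.
have /andP[k0 k1] := k01.
have W1a : A1const (EFin \o W 1%R) <= a%:E.
  by rewrite W1 (le_trans wc).
pose phi s := fine (A1const (EFin \o W s)).
have phiE s : (D^-1 <= s <= 1)%R -> A1const (EFin \o W s) = (phi s)%:E.
  move=> /andP[ks s1]; rewrite fineK// ge0_fin_numE ?Lnorm_ge0//.
  have s0 := lt_le_trans k0 ks.
  exact: le_lt_trans (A1const_W _ _ _ s0 s1 (ltW a0) W1a) (ltry _).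
have phi_ge0 s : (0 <= phi s)%R by rewrite fine_ge0// Lnorm_ge0.
have [||s ks phis] := IVT_no_downward_jump (phi := phi) k01 a0.
- move=> s t ks st t1; have s0 := lt_le_trans k0 ks.
  have t0 := lt_le_trans s0 st.
  have := A1const_W s t (phi t) s0 st (phi_ge0 t).
  rewrite !phiE ?(le_trans ks st) ?ks ?(le_trans st t1)//.
  rewrite lexx lee_fin => /(_ isT).
  by rewrite mulrAC ler_pdivlMr// mulrC.
- apply/andP; split; first by rewrite -lee_fin -phiE// lexx andbT.
  rewrite leNgt; apply/negP => phia.
  have := lexx (A1const (EFin \o W D^-1%R)).
  rewrite {2}phiE ?lexx//.
  move=> /A1const_leP => /(_ (fun x => W0 _ x k0)) h.
  have [x Ax Mx] := ae_exists mA A0 h.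
  have : maximal (fun y => (w y)%:E * (\1_(~` A) y)%:E) x
      <= maximal (EFin \o W D^-1%R) x.
    rewrite !maximalE; apply: le_wmaximal.
    + by move=> y; exact: ltr01.
    + exact: measurable_cst.
    + apply: emeasurable_funM; first exact/measurable_EFinP.
      by apply/measurable_EFinP/measurable_indic; exact: measurableC.
    + exact/measurable_EFinP.
    + move=> y; rewrite -EFinM lee_fin [leRHS]gtr0_norm ?W0//.
      rewrite ger0_norm; last by rewrite indicE mulr_ge0 ?ler0n// ltW.
      rewrite WE indicE in_setC; case: ifP => _ /=.
        by rewrite mulr0 mulr_ge0// ltW.
      by rewrite mulr1.
  move=> /le_trans /(_ Mx) => le2.
  have := le_trans (Aw x Ax) (lee_wpmul2l _ le2).
  rewrite lee_fin exprn_ge0// => /(_ isT).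
  rewrite -EFinM lee_fin WE mem_set// leNgt => /negP; apply.
  have : (2 ^+ n.+1 * (phi D^-1 * (D^-1 * w x)) < 2 ^+ n.+1 * (a * (D^-1 * w x)))%R.
    by rewrite ltr_pM2l ?exprn_gt0// ltr_pM2r// mulr_gt0.
  by rewrite [ltRHS]mulrA [ltRHS]mulrA -/D mulfV// mul1r.
have /andP[ks' s1] := ks; have s0 := lt_le_trans k0 ks'.
exists (W s); split => //.
- by move=> x; exact: W0.
- move=> x; have := W_comparable s 1%R x s0 s1; rewrite W1 => /andP[-> h]/=.
  rewrite (le_trans h)// ler_wpM2r ?(ltW (W0 _ _ s0))// mul1r -/D.
  by rewrite -[leRHS]invrK lef_pV2 ?posrE// invr_gt0.
- by rewrite phiE// phis.
Qed.

End A1_prescribed.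

(** * Young functions *)

Section young_functions.
Variables (R : realType) (Phi : R -> R).
Hypothesis PhiY : young Phi.
Local Notation Psi := (complementary Phi).

Lemma le_young s t : (0 <= s)%R -> (s <= t)%R -> (Phi s <= Phi t)%R.
Proof.
move=> s0; rewrite le_eqVlt => /predU1P[->//|st].
apply/ltW/(young_increasing PhiY) => //; rewrite in_itv/= andbT//.
exact: (le_trans s0 (ltW st)).
Qed.

Lemma young_quotient_small (e : R) : (0 < e)%R ->
  exists t, [/\ 0 < t, t <= 1 & Phi t < e * t]%R.
Proof.
move=> e0; have /cvgr0Pnorm_lt/(_ e e0) h := young_cvg0 PhiY.
near (0%R : R)^'+ => t; exists t.
have t0 : (0 < t)%R by near: t; exact: nbhs_right_gt.
split => //; first by near: t; exact: nbhs_right_le.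
rewrite -ltr_pdivrMr//; apply: le_lt_trans (ler_norm _) _.
by near: t; exact: h.
Unshelve. all: by end_near. Qed.

Lemma young0 : Phi 0 = 0%R.
Proof.
apply/eqP; rewrite eq_le (young_ge0 PhiY) ?lexx// andbT leNgt; apply/negP => P0.
have [t [t0 t1 Pt]] := young_quotient_small P0.
have := le_young (lexx _) (ltW t0).
rewrite leNgt (lt_le_trans Pt)// ler_piMr// ltW//.
Qed.

Lemma young_gt0 t : (0 < t)%R -> (0 < Phi t)%R.
Proof.
move=> t0; rewrite -young0; apply: (young_increasing PhiY) => //.
- by rewrite in_itv/= lexx.
- by rewrite in_itv/= andbT ltW.
Qed.

Lemma young_star_shaped (c t : R) : (0 <= c <= 1)%R -> (0 <= t)%R ->
  (Phi (c * t) <= c * Phi t)%R.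
Proof.
move=> /andP[c0 c1] t0.
have cx := young_convex PhiY (Itv01 c0 c1).
have : (Phi (c * t + (1 - c) * 0) <= c * Phi t + (1 - c) * Phi 0)%R.
  by apply: (cx t 0%R); rewrite inE/= in_itv/= ?andbT ?lexx.
by rewrite young0 !mulr0 !addr0.
Qed.

(** In the supremum over [s] that defines the left-hand side, [s <= t] gives at
    most [Phi t], and convexity makes the terms with [s > t] nonpositive. *)
Lemma complementary_quotient t : (0 < t)%R -> Psi (Phi t / t)%:E <= (Phi t)%:E.
Proof.
move=> t0; apply: ge_ereal_sup => _ [s s0 <-].
rewrite -EFinM -EFinB lee_fin.
have [st|ts] := leP s t.
  have Ps : (0 <= Phi s)%R by rewrite (young_ge0 PhiY)// ltW.
  have : (s * (Phi t / t) <= Phi t)%R.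
    by rewrite mulrA ler_pdivrMr// mulrC ler_wpM2l// ltW// young_gt0.
  lra.
have : (t / s <= 1)%R by rewrite ler_pdivrMr// mul1r ltW.
move=> ts1; have := @young_star_shaped (t / s) s.
rewrite divr_ge0 ?(ltW t0) ?(ltW s0)// ts1 => /(_ isT isT).
rewrite divfK ?gt_eqF// => Pts.
have : (s * (Phi t / t) <= Phi s)%R.
  by rewrite mulrA ler_pdivrMr// mulrC -ler_pdivlMr// -mulrA mulrC.
have := young_gt0 t0; lra.
Qed.

Lemma complementary_ge0 t : 0 <= t -> 0 <= Psi t.
Proof.
move=> t0; apply/lee_addgt0Pr => e e0.
have [s [s0 s1 Ps]] := young_quotient_small e0.
rewrite -leeBlDr// sub0e; apply: (@le_trans _ _ (s%:E * t - (Phi s)%:E)).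
  rewrite -[leLHS]add0e leeD//; first by rewrite mule_ge0// lee_fin ltW.
  by rewrite -EFinN lee_fin lerN2 (le_trans (ltW Ps))// ler_piMr// ltW.
by apply: ereal_sup_ubound; exists s.
Qed.

Lemma young_inequality_EFin (s : R) t : (0 <= s)%R -> 0 <= t ->
  s%:E * t <= (Phi s)%:E + Psi t.
Proof.
rewrite le_eqVlt => /predU1P[<-|s0] t0.
  by rewrite mul0e young0 add0e complementary_ge0.
by rewrite -leeBlDl//; apply: ereal_sup_ubound; exists s.
Qed.

Lemma young_inequality s t : 0 <= s -> 0 <= t -> s * t <= er_map Phi s + Psi t.
Proof.
case: s => [s|_ t0|//].
  by rewrite lee_fin /=; exact: young_inequality_EFin.
rewrite /= addye ?leey//.
by apply: contraTneq (complementary_ge0 t0) => ->.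
Qed.

(** Jensen's inequality for coefficients of sum at most [1], read off the
    definition of [Psi] as a supremum of affine functions. *)
Lemma complementary_nneseries (l : nat -> R) (a : nat -> \bar R) :
  (forall k, 0 <= l k)%R -> \sum_(k <oo) (l k)%:E <= 1 -> (forall k, 0 <= a k) ->
  Psi (\sum_(k <oo) (l k)%:E * a k) <= \sum_(k <oo) (l k)%:E * Psi (a k).
Proof.
move=> l0 l1 a0; apply: ge_ereal_sup => _ [s s0 <-].
have Ps : (0 <= Phi s)%R by rewrite (young_ge0 PhiY)// ltW.
rewrite leeBlDl// -nneseriesZl; last by move=> k _; rewrite mule_ge0// lee_fin.
apply: (@le_trans _ _ (\sum_(k <oo) ((Phi s)%:E * (l k)%:E + (l k)%:E * Psi (a k)))).
  apply: lee_nneseries => k _.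
    by rewrite !mule_ge0 ?lee_fin// ltW.
  rewrite muleCA [X in _ <= X + _]muleC -muleDr; last 2 first.
  - by [].
  - by rewrite ge0_adde_def// inE ?lee_fin// complementary_ge0.
  apply: lee_wpmul2l; first by rewrite lee_fin.
  by apply: young_inequality_EFin => //; exact: ltW.
rewrite nneseriesD; last 2 first.
- by move=> k _ _; rewrite mule_ge0// lee_fin.
- by move=> k _ _; rewrite mule_ge0 ?lee_fin// complementary_ge0.
rewrite leeD2r// nneseriesZl; last by move=> k _; rewrite lee_fin.
by rewrite -[leRHS]mule1 lee_wpmul2l.
Qed.

Lemma complementaryZ_le (c : R) t : (0 <= c <= 1)%R -> 0 <= t ->
  Psi (c%:E * t) <= c%:E * Psi t.
Proof.
move=> /andP[c0 c1] t0; apply: ge_ereal_sup => _ [s s0 <-].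
have Ps : (0 <= Phi s)%R by rewrite (young_ge0 PhiY)// ltW.
rewrite leeBlDl// muleCA.
apply: (@le_trans _ _ (c%:E * ((Phi s)%:E + Psi t))).
  apply: lee_wpmul2l; first by rewrite lee_fin.
  by apply: young_inequality_EFin => //; exact: ltW.
rewrite ge0_muleDr ?lee_fin ?complementary_ge0// leeD2r//.
by rewrite -EFinM lee_fin ler_piMl.
Qed.

Lemma le_complementary : {homo Psi : s t / s <= t}.
Proof.
move=> s t st; apply: ge_ereal_sup => _ [r r0 <-].
apply: (@le_trans _ _ (r%:E * t - (Phi r)%:E)).
  by rewrite leeB// lee_wpmul2l// lee_fin ltW.
by apply: ereal_sup_ubound; exists r.
Qed.

Lemma complementaryy : Psi +oo = +oo.
Proof.
apply/eqP; rewrite -leye_eq; apply: ereal_sup_ubound; exists 1%R => //=.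
by rewrite mul1e.
Qed.

(** The superlevel sets of a nondecreasing function are intervals. *)
Lemma measurable_complementary : measurable_fun [set: \bar R] Psi.
Proof.
move=> mT; apply: (measurability _ (ErealGenOInfty.measurableE R)) => //.
move=> _ [_ [r ->] <-]; rewrite setTI.
set U := _ @^-1` _.
have upU s t : U s -> s <= t -> U t.
  rewrite /U /= !in_itv/= !andbT => rs st.
  exact: lt_le_trans rs (le_complementary st).
have [UI|UI] := pselect (U (ereal_inf U)).
  rewrite (_ : U = `[ereal_inf U, +oo[%classic); first exact: emeasurable_itv.
  apply/seteqP; split => t /=; rewrite in_itv/= andbT.
    exact: ereal_inf_lbound.
  exact: upU.
rewrite (_ : U = `]ereal_inf U, +oo[%classic); first exact: emeasurable_itv.
apply/seteqP; split => t /=; rewrite in_itv/= andbT.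
  move=> Ut; rewrite lt_neqAle ereal_inf_lbound// andbT.
  by apply: contra_notN UI => /eqP ->.
by move=> /ereal_inf_lt[s Us /ltW]; exact: upU.
Qed.

Lemma measurable_er_map_young d (T : measurableType d) (g : T -> \bar R) :
  measurable_fun [set: T] g -> (forall x, 0 <= g x) ->
  measurable_fun [set: T] (fun x => er_map Phi (g x)).
Proof.
move=> mg g0; pose phi (t : R) := Phi (Num.max t 0)%R.
rewrite (_ : (fun x => _) = er_map phi \o g); last first.
  apply/funext => x /=; have := g0 x; case: (g x) => //= r.
  by rewrite lee_fin => r0; rewrite /phi max_l.
apply: measurableT_comp mg; apply: (@measurable_er_map _ T).
apply: nondecreasing_measurable; first exact: measurableT.
move=> s t st; apply: le_young.
  by rewrite le_max lexx orbT.
by rewrite ge_max !le_max st lexx orbT.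
Qed.

Lemma young_unbounded (M : R) : exists2 t, (0 <= t)%R & (M <= Phi t)%R.
Proof.
have /cvgryPge/(_ 1%R) h := young_cvgy PhiY.
near (+oo%R : set_system R) => t.
have tM : (Num.max 1 M <= t)%R by near: t; apply: nbhs_pinfty_ge; exact: num_real.
have t0 : (0 < t)%R by rewrite (lt_le_trans _ tM)// lt_max ltr01.
exists t; first exact: ltW.
apply: (@le_trans _ _ t); first by rewrite (le_trans _ tM)// le_max lexx orbT.
have : (1 <= Phi t / t)%R by near: t; exact: h.
by rewrite ler_pdivlMr// mul1r.
Unshelve. all: by end_near. Qed.

(** Were the dilation function infinite at [c], it would be infinite beyond
    [c], and the upper index would be infinite. *)
Lemma young_doubling (c : R) : upper_index Phi < +oo -> (1 <= c)%R ->
  exists2 D : R, (0 < D)%R & forall s, (0 <= s)%R -> (Phi (c * s) <= D * Phi s)%R.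
Proof.
move=> idx c1.
have [dc|dc] := eqVneq (dilation Phi c) +oo.
  suff h : upper_index Phi = +oo by rewrite h ltxx in idx.
  apply: cvg_lim => //; apply: cvg_near_cst.
  near=> t.
  have ct : (c < t)%R by near: t; apply: nbhs_pinfty_gt; exact: num_real.
  have -> : dilation Phi t = +oo.
    apply/eqP; rewrite -leye_eq -dc; apply: ge_ereal_sup => _ [s s0 <-].
    apply: (@le_trans _ _ (Phi (s * t) / Phi s)%:E).
      rewrite lee_fin ler_wpM2r ?invr_ge0 ?(young_ge0 PhiY (ltW s0))//.
      apply: le_young; first by rewrite mulr_ge0 ?(ltW s0)// (le_trans ler01).
      by rewrite ler_wpM2l ?(ltW s0) ?(ltW ct).
    by apply: ereal_sup_ubound; exists s.
  rewrite /= inver gt_eqF ?ln_gt0 ?(le_lt_trans c1)//.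
  by rewrite gt0_mulye// lte_fin invr_gt0 ln_gt0 ?(le_lt_trans c1).
have dilc s : (0 < s)%R -> (Phi (s * c) / Phi s)%:E <= dilation Phi c.
  by move=> s0; apply: ereal_sup_ubound; exists s.
have dc1 : (0 < fine (dilation Phi c))%R.
  have := dilc 1%R ltr01; case: (dilation Phi c) dc => [r|//|//] _ /=.
  rewrite lee_fin; apply: lt_le_trans.
  by rewrite divr_gt0 ?young_gt0// mul1r (lt_le_trans ltr01).
have dcE : dilation Phi c = (fine (dilation Phi c))%:E.
  by case: (dilation Phi c) dc dc1 => [r|//|] //; rewrite /= ltxx.
exists (fine (dilation Phi c)) => // s; rewrite le_eqVlt => /predU1P[<-|s0].
  by rewrite mulr0 young0 mulr0.
by have := dilc s s0; rewrite dcE lee_fin ler_pdivrMr ?young_gt0// mulrC.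
Unshelve. all: by end_near. Qed.

End young_functions.

(** * The Rubio de Francia algorithm *)

Section rubio_de_francia.
Variables (R : realType) (n : nat).
Local Notation T := (Rn R n).
Local Notation mu := (leb R n).

Lemma cubes_integral_ae_eq (f g : T -> \bar R) (Q : set T) :
  cubes Q -> measurable_fun [set: T] f -> measurable_fun [set: T] g ->
  {ae mu, forall x, f x = g x} ->
  \int[mu]_(x in Q) f x = \int[mu]_(x in Q) g x.
Proof.
move=> cQ mf mg fg; apply: ae_eq_integral.
- exact: cubes_measurable.
- exact: measurable_funTS.
- exact: measurable_funTS.
- by apply: filterS fg => x -> _.
Qed.

Lemma maximal_ae_eq (f g : T -> \bar R) :
  measurable_fun [set: T] f -> measurable_fun [set: T] g ->
  {ae mu, forall x, f x = g x} -> maximal f = maximal g.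
Proof.
move=> mf mg fg; apply/funext => x; congr ereal_sup.
apply: eq_imagel => Q [cQ _]; congr (_ * _).
apply: (cubes_integral_ae_eq cQ).
- by apply: measurableT_comp mf; exact: abse_measurable.
- by apply: measurableT_comp mg; exact: abse_measurable.
- by apply: filterS fg => y ->.
Qed.

Lemma wmaximal_ae_eq (v v' f : T -> \bar R) :
  measurable_fun [set: T] v -> measurable_fun [set: T] v' ->
  measurable_fun [set: T] f ->
  {ae mu, forall x, v x = v' x} -> wmaximal v f = wmaximal v' f.
Proof.
move=> mv mv' mf vv'; apply/funext => x; congr ereal_sup.
have maf : measurable_fun [set: T] (abse \o f).
  by apply: measurableT_comp mf; exact: abse_measurable.
apply: eq_imagel => Q [cQ _]; congr (_^-1 * _).
  exact: (cubes_integral_ae_eq cQ mv mv' vv').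
apply: (cubes_integral_ae_eq cQ).
- exact: (emeasurable_funM maf mv).
- exact: (emeasurable_funM maf mv').
- by apply: filterS vv' => y ->.
Qed.

(** The shift by one keeps the side of [big_cube 0] positive. *)
Definition big_cube (k : nat) : set T :=
  cube [tuple (- k.+1%:R)%R | i < n] (k.+1%:R + k.+1%:R).

Lemma big_cubeE k x : big_cube k x <-> forall i, (`|tnth x i| < k.+1%:R)%R.
Proof.
split=> h i; have := h i; rewrite ?tnth_mktuple ltr_norml; lra.
Qed.

Lemma cubes_big_cube k : cubes (big_cube k).
Proof.
by exists [tuple (- k.+1%:R)%R | i < n], (k.+1%:R + k.+1%:R)%R; rewrite addr_gt0.
Qed.

Lemma nondecreasing_big_cube : nondecreasing_seq big_cube.
Proof.
move=> j k jk; apply/subsetPset => x /big_cubeE xj; apply/big_cubeE => i.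
by rewrite (lt_le_trans (xj i))// ler_nat ltnS.
Qed.

Lemma big_cube_near x : \forall k \near \oo, big_cube k x.
Proof.
have [m mx] : exists m : nat, forall i, (`|tnth x i| < m%:R)%R.
  exists (\max_(i < n) (Num.truncn `|tnth x i|).+1) => i.
  rewrite (lt_le_trans (truncnS_gt _))// ler_nat.
  exact: (leq_bigmax (F := fun i => (Num.truncn `|tnth x i|).+1) i).
near=> k; apply/big_cubeE => i; rewrite (lt_le_trans (mx i))// ler_nat.
by rewrite leqW//; near: k; exact: nbhs_infty_ge.
Unshelve. all: by end_near. Qed.

Lemma bigcup_big_cube : \bigcup_k big_cube k = [set: T].
Proof.
apply/seteqP; split => // x _; have [k _ kx] := big_cube_near x.
by exists k => //; exact: (kx k (leqnn k)).
Qed.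

Variable v : T -> R.
Hypothesis v0 : forall x, (0 < v x)%R.
Hypothesis mv : measurable_fun [set: T] v.
Hypothesis vQ : forall Q : set T, cubes Q -> 0 < wmeas (EFin \o v) Q < +oo.
Local Notation Mv := (wmaximal (EFin \o v)).

(** A large enough cube around [x] meets the support of [f]. *)
Lemma wmaximal_gt0 (f : T -> \bar R) x : measurable_fun [set: T] f ->
  (forall y, 0 <= f y) -> 0 < \int[mu]_y (f y * (v y)%:E) -> 0 < Mv f x.
Proof.
move=> mf f0 fv0.
have fv_ge0 y : 0 <= f y * (v y)%:E by rewrite mule_ge0// lee_fin ltW.
have mfv : measurable_fun [set: T] (fun y => f y * (v y)%:E).
  by apply: (emeasurable_funM mf); exact/measurable_EFinP.
have [k kx k0] : exists2 k, big_cube k x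
    & 0 < \int[mu]_(y in big_cube k) (f y * (v y)%:E).
  apply: contrapT => h.
  have hx : \forall k \near \oo, \int[mu]_(y in big_cube k) (f y * (v y)%:E) = 0.
    apply: filterS (big_cube_near x) => k kx; apply/eqP.
    rewrite eq_le integral_ge0 ?andbT// leNgt; apply/negP => k0.
    by apply: h; exists k.
  have cvg_fv : \int[mu]_(y in big_cube k) (f y * (v y)%:E) @[k --> \oo] -->
      \int[mu]_(y in \bigcup_k big_cube k) (f y * (v y)%:E).
    apply: ge0_nondecreasing_set_cvg_integral.
    - exact: nondecreasing_big_cube.
    - by move=> k; exact/cubes_measurable/cubes_big_cube.
    - by move=> k; exact: measurable_funTS.
    - by move=> k y _.
  have := cvg_lim (@ereal_hausdorff R) cvg_fv.
  rewrite bigcup_big_cube (cvg_lim (@ereal_hausdorff R) (cvg_near_cst _ hx)).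
  by move=> fv_eq0; move: fv0; rewrite -fv_eq0 ltxx.
have cQ := cubes_big_cube k; have /andP[vQ0 vQy] := vQ cQ.
apply: (@lt_le_trans _ _ ((wmeas (EFin \o v) (big_cube k))^-1 *
    \int[mu]_(y in big_cube k) (`|f y| * (EFin \o v) y))).
  rewrite mule_gt0//; first by rewrite inve_gt0 ?(gt_eqF vQ0) ?(lt_eqF vQy).
  by rewrite (eq_integral (fun y => f y * (v y)%:E))// => y _; rewrite gee0_abs.
by apply: ereal_sup_ubound; exists (big_cube k).
Qed.

(** The factor [K^-1 ^+ k] compensates the modular norm of the [k]-th iterate of
    the maximal operator, and the factors [2 ^- k.+1] sum to [1]. *)
Definition rdf_coef (K : R) k : R := (K^-1 ^+ k / (2 ^ k.+1)%:R)%R.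

Definition rdf (K : R) (h : T -> \bar R) (x : T) : \bar R :=
  \sum_(k <oo) (rdf_coef K k)%:E * iter k Mv h x.

Lemma rdf_coef_gt0 K k : (0 < K)%R -> (0 < rdf_coef K k)%R.
Proof. by move=> K0; rewrite divr_gt0// ?exprn_gt0 ?invr_gt0// ltr0n expn_gt0. Qed.

Variables (K : R) (h : T -> \bar R).
Hypothesis K1 : (1 <= K)%R.
Hypothesis mh : measurable_fun [set: T] h.
Hypothesis h0 : forall x, 0 <= h x.

Let K0 : (0 < K)%R. Proof. exact: lt_le_trans K1. Qed.

Let miter k : measurable_fun [set: T] (iter k Mv h).
Proof. by case: k => [|k]; [exact: mh|exact: measurable_wmaximal]. Qed.

Let iter_ge0 k x : 0 <= iter k Mv h x.
Proof. by case: k => //= k; exact: wmaximal_ge0. Qed.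

Let term_ge0 k x : 0 <= (rdf_coef K k)%:E * iter k Mv h x.
Proof. by rewrite mule_ge0// lee_fin ltW// rdf_coef_gt0. Qed.

Let mterm k : measurable_fun [set: T] (fun x => (rdf_coef K k)%:E * iter k Mv h x).
Proof. by apply: emeasurable_funM => //; exact: measurable_cst. Qed.

Let term_le_rdf k x : (rdf_coef K k)%:E * iter k Mv h x <= rdf K h x.
Proof.
rewrite /rdf (nneseriesD1 (n := k))//.
rewrite leeDl//; exact: nneseries_ge0.
Qed.

Lemma measurable_rdf : measurable_fun [set: T] (rdf K h).
Proof. by apply: ge0_emeasurable_sum => // k x _ _; exact: term_ge0. Qed.

Lemma rdf_ge0 x : 0 <= rdf K h x.
Proof. by apply: nneseries_ge0 => k _ _; exact: term_ge0. Qed.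

Lemma le_rdf x : h x <= 2%:E * rdf K h x.
Proof.
rewrite -lee_pdivrMl//; apply: le_trans (term_le_rdf 0 x).
by rewrite /rdf_coef /= expr0 mul1r expn1.
Qed.

Lemma rdf_gt0 x : 0 < \int[mu]_y (h y * (v y)%:E) -> 0 < rdf K h x.
Proof.
move=> hv0; apply: lt_le_trans (term_le_rdf 1 x).
by rewrite mule_gt0 ?lte_fin ?rdf_coef_gt0//= wmaximal_gt0.
Qed.

(** Applying [Mv] shifts the series by one index, and consecutive coefficients
    have ratio [2 * K]. *)
Lemma wmaximal_rdf x : Mv (rdf K h) x <= (2 * K)%:E * rdf K h x.
Proof.
apply: le_trans (wmaximal_nneseries _ _ _ _ _ _) _ => //.
rewrite /rdf -nneseriesZl//.
apply: (@le_trans _ _ (\sum_(k <oo) (2 * K)%:E *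
    ((rdf_coef K k.+1)%:E * iter k.+1 Mv h x))).
  apply: lee_nneseries => k _.
    by move=> _; exact: wmaximal_ge0.
  rewrite muleA -EFinM (_ : 2 * K * _ = rdf_coef K k)%R; last first.
    rewrite /rdf_coef expnS exprS natrM; field.
    by rewrite pnatr_eq0 expn_eq0/= gt_eqF.
  apply: wmaximalZ_le => //; exact/ltW/rdf_coef_gt0.
pose g k := (2 * K)%:E * ((rdf_coef K k)%:E * iter k Mv h x).
have g0 k : 0 <= g k by rewrite mule_ge0// lee_fin mulr_ge0// ltW.
rewrite -[leLHS]/(\sum_(k <oo) g k.+1) -[leRHS]/(\sum_(k <oo) g k).
rewrite (eq_eseriesr (g := fun k => g (k + 1)%N)); last first.
  by move=> k _; rewrite addn1.
by rewrite nneseries_addn// [leRHS]nneseries_recl// leeDr.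
Qed.

(** Iterating the hypothesis bounds the modular of the [k]-th iterate by [K ^+ k]
    times that of [h], so that, by convexity, the [k]-th term of the series
    contributes at most [2 ^- k.+1] times the modular of [h]. *)
Lemma rdf_modular (Phi : R -> R) (u : T -> R) : young Phi ->
  (forall x, 0 < u x)%R -> measurable_fun [set: T] u ->
  (forall f : T -> \bar R, measurable_fun [set: T] f ->
    \int[mu]_x (complementary Phi (Mv f x * (u x)%:E) * (v x)%:E)
    <= K%:E * \int[mu]_x (complementary Phi (`|f x| * (u x)%:E) * (v x)%:E)) ->
  \int[mu]_x (complementary Phi (rdf K h x * (u x)%:E) * (v x)%:E)
    <= \int[mu]_x (complementary Phi (h x * (u x)%:E) * (v x)%:E).
Proof.
move=> PhiY u0 mu_ Mv_modular.
pose J f := \int[mu]_x (complementary Phi (f x * (u x)%:E) * (v x)%:E).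
have mPsi (f : T -> \bar R) : measurable_fun [set: T] f ->
    measurable_fun [set: T] (fun x => complementary Phi (f x * (u x)%:E) * (v x)%:E).
  move=> mf; apply: emeasurable_funM; last exact/measurable_EFinP.
  apply: measurableT_comp; first exact: measurable_complementary.
  by apply: emeasurable_funM mf _; exact/measurable_EFinP.
have Psi0 (f : T -> \bar R) x : (forall x, 0 <= f x) ->
    0 <= complementary Phi (f x * (u x)%:E) * (v x)%:E.
  move=> f0; rewrite mule_ge0 ?complementary_ge0 ?mule_ge0// lee_fin ltW//.
have J_iter k : J (iter k Mv h) <= (K ^+ k)%:E * J h.
  elim: k => [|k IH]; first by rewrite expr0 mul1e.
  apply: (le_trans (Mv_modular _ (miter k))).
  rewrite exprS EFinM -muleA; apply: lee_wpmul2l; first by rewrite lee_fin ltW.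
  apply: le_trans IH; rewrite le_eqVlt; apply/orP; left; apply/eqP.
  by apply: eq_integral => x _; rewrite gee0_abs.
have K_inv k : (rdf_coef K k * K ^+ k = 1 / (2 ^ k.+1)%:R)%R.
  rewrite /rdf_coef exprVn; field.
  by rewrite pnatr_eq0 expn_eq0/= expf_neq0// gt_eqF.
have sum_coef : \sum_(k <oo) (rdf_coef K k)%:E <= 1.
  apply: le_trans (epsilon_trick0 xpredT ler01); apply: lee_nneseries => k _.
    by move=> _; rewrite lee_fin ltW// rdf_coef_gt0.
  by rewrite lee_fin -K_inv ler_peMr ?exprn_ege1// ltW// rdf_coef_gt0.
apply: (@le_trans _ _ (\int[mu]_x \sum_(k <oo) (rdf_coef K k)%:E *
    (complementary Phi (iter k Mv h x * (u x)%:E) * (v x)%:E))).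
  apply: (ge0_le_integral _ measurableT).
  - by move=> x _; apply: Psi0; exact: rdf_ge0.
  - exact: mPsi measurable_rdf.
  - apply: ge0_emeasurable_sum => k.
      by move=> x _ _; rewrite mule_ge0 ?Psi0// lee_fin ltW// rdf_coef_gt0.
    by move=> _; apply: emeasurable_funM; [exact: measurable_cst|exact: mPsi].
  move=> x _.
  have -> : rdf K h x * (u x)%:E =
      \sum_(k <oo) (rdf_coef K k)%:E * (iter k Mv h x * (u x)%:E).
    rewrite muleC /rdf -nneseriesZl//; apply: eq_eseriesr => k _.
    by rewrite muleCA (muleC (u x)%:E).
  apply: (@le_trans _ _ ((\sum_(k <oo) (rdf_coef K k)%:E *
      complementary Phi (iter k Mv h x * (u x)%:E)) * (v x)%:E)).
    apply: lee_wpmul2r; first by rewrite lee_fin ltW.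
    apply: complementary_nneseries => // k; first exact/ltW/rdf_coef_gt0.
    by rewrite mule_ge0// lee_fin ltW.
  rewrite muleC -nneseriesZl; last first.
    move=> k _; rewrite mule_ge0//; first by rewrite lee_fin ltW// rdf_coef_gt0.
    by apply: complementary_ge0 => //; rewrite mule_ge0// lee_fin ltW.
  rewrite le_eqVlt; apply/orP; left; apply/eqP; apply: eq_eseriesr => k _.
  by rewrite muleCA (muleC (v x)%:E).
rewrite (integral_nneseries _ measurableT); last 2 first.
- by move=> k; apply: emeasurable_funM; [exact: measurable_cst|exact: mPsi].
- by move=> k x _; rewrite mule_ge0 ?Psi0// lee_fin ltW// rdf_coef_gt0.
apply: (@le_trans _ _ (\sum_(k <oo) J h * (1 / (2 ^ k.+1)%:R)%:E)).
  apply: lee_nneseries => k _.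
    move=> _; apply: integral_ge0 => x _.
    by rewrite mule_ge0 ?Psi0// lee_fin ltW// rdf_coef_gt0.
  rewrite (ge0_integralZl_EFin _ measurableT); last 3 first.
  - by move=> x _; exact: Psi0.
  - exact: mPsi.
  - exact/ltW/rdf_coef_gt0.
  rewrite -K_inv (EFinM (rdf_coef K k)) muleCA; apply: lee_wpmul2l.
    by rewrite lee_fin ltW// rdf_coef_gt0.
  by rewrite muleC; exact: J_iter.
have J0 : 0 <= J h by apply: integral_ge0 => x _; exact: Psi0.
have [Jh|Jh] := eqVneq (J h) +oo; first by rewrite -/(J h) Jh leey.
rewrite -/(J h) -(fineK (_ : J h \is a fin_num)) ?ge0_fin_numE ?ltey//.
rewrite nneseriesZl; last by move=> k _; rewrite lee_fin.
rewrite -[leRHS]mule1; apply: lee_wpmul2l; last exact: epsilon_trick0.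
by rewrite lee_fin fine_ge0.
Qed.

End rubio_de_francia.

(** * Extrapolation for positive real weights *)

Section modular_extrapolation.
Variables (R : realType) (n : nat).
Hypothesis n_gt0 : (0 < n)%N.
Local Notation T := (Rn R n).
Local Notation mu := (leb R n).
Variables (Phi : R -> R) (v a : T -> R) (K c : R).
Hypothesis PhiY : young Phi.
Hypothesis v0 : forall x, (0 < v x)%R.
Hypothesis mv : measurable_fun [set: T] v.
Hypothesis vc : A1const (EFin \o v) <= c%:E.
Hypothesis a0 : forall x, (0 < a x)%R.
Hypothesis ma : measurable_fun [set: T] a.
Hypothesis K1 : (1 <= K)%R.
Local Notation Mv := (wmaximal (EFin \o v)).
Local Notation Psi := (complementary Phi).
Hypothesis Mv_modular : forall f : T -> \bar R, measurable_fun [set: T] f ->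
  \int[mu]_x (Psi (Mv f x * (a x)^-1%:E) * (v x)%:E)
  <= K%:E * \int[mu]_x (Psi (`|f x| * (a x)^-1%:E) * (v x)%:E).

Let K0 : (0 < K)%R. Proof. exact: lt_le_trans K1. Qed.

Let c_ge0 : (0 <= c)%R.
Proof. by rewrite -lee_fin (le_trans _ vc)// Lnorm_ge0. Qed.

Let vQ : forall Q : set T, cubes Q -> 0 < wmeas (EFin \o v) Q < +oo.
Proof. exact: A1_cubes v0 mv vc. Qed.

Let aV0 x : (0 < (a x)^-1)%R. Proof. by rewrite invr_gt0. Qed.

Let maV : measurable_fun [set: T] (fun x => (a x)^-1)%R.
Proof.
rewrite (_ : (fun x => _) = (fun x => a x `^ (-1))%R); last first.
  by apply/funext => x; rewrite powR_inv1// ltW.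
exact: measurableT_comp (measurable_powR _) ma.
Qed.

Lemma measurable_Psi (h : T -> \bar R) : measurable_fun [set: T] h ->
  measurable_fun [set: T] (fun x => Psi (h x * (a x)^-1%:E) * (v x)%:E).
Proof.
move=> mh; apply: emeasurable_funM; last exact/measurable_EFinP.
apply: measurableT_comp; first exact: measurable_complementary.
by apply: emeasurable_funM mh _; exact/measurable_EFinP.
Qed.

Lemma Psi_ge0 (h : T -> \bar R) x : (forall x, 0 <= h x) ->
  0 <= Psi (h x * (a x)^-1%:E) * (v x)%:E.
Proof.
move=> h0; apply: mule_ge0; last by rewrite lee_fin ltW.
by apply: complementary_ge0 => //; rewrite mule_ge0// lee_fin ltW.
Qed.

(** By [maximalM], the maximal function of [rdf v K h * v] is at most the product
    of that of [v], which is at most [c * v], and of [Mv (rdf v K h)], which is at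
    most [2 * K * rdf v K h].  The series is finite almost everywhere because its
    modular is finite, and positive because [h] is not negligible. *)
Lemma A1_rdf (h : T -> \bar R) : measurable_fun [set: T] h ->
  (forall x, 0 <= h x) -> 0 < \int[mu]_x (h x * (v x)%:E) ->
  \int[mu]_x (Psi (h x * (a x)^-1%:E) * (v x)%:E) < +oo ->
  exists w : T -> R, [/\ measurable_fun [set: T] w, forall x, (0 < w x)%R,
    {ae mu, forall x, rdf v K h x * (v x)%:E = (w x)%:E}
    & A1const (EFin \o w) <= (2 * K * c)%:E].
Proof.
move=> mh h0 hv0 Psih.
pose H := rdf v K h.
have mH : measurable_fun [set: T] H by exact: measurable_rdf.
have H0 x : 0 < H x by exact: rdf_gt0.
have Hge0 x : 0 <= H x by exact: ltW.
have mPsiH := measurable_Psi mH.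
have PsiH : \int[mu]_x (Psi (H x * (a x)^-1%:E) * (v x)%:E) < +oo.
  apply: le_lt_trans Psih.
  exact: (rdf_modular v0 mv K1 mh h0 PhiY aV0 maV Mv_modular).
have Hfin : {ae mu, forall x, H x < +oo}.
  have : mu.-integrable [set: T] (fun x => Psi (H x * (a x)^-1%:E) * (v x)%:E).
    apply/integrableP; split => //.
    rewrite (eq_integral (fun x => Psi (H x * (a x)^-1%:E) * (v x)%:E))//.
    by move=> x _; rewrite gee0_abs// Psi_ge0.
  move=> /(integrable_ae measurableT); apply: filterS => x /(_ Logic.I).
  move=> PsiHx; rewrite ltey; apply: contraTneq PsiHx => ->.
  by rewrite gt0_mulye ?lte_fin// complementaryy// gt0_mulye ?lte_fin.
pose w x := if H x < +oo then (fine (H x) * v x)%R else 1%R.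
have Hw x : H x < +oo -> H x * (v x)%:E = (w x)%:E.
  by move=> Hx; rewrite /w Hx EFinM fineK// ge0_fin_numE.
have w0 x : (0 < w x)%R.
  rewrite /w; case: ifPn => // Hx.
  by rewrite mulr_gt0// fine_gt0// H0.
have mw : measurable_fun [set: T] w.
  apply: measurable_fun_ifT; last exact: measurable_cst.
  - by apply: measurable_fun_lte; [exact: mH|exact: measurable_cst].
  - apply: measurable_funM mv.
    by apply: measurableT_comp mH; exact: fine_measurable.
exists w; split => //; first by apply: filterS Hfin => x /Hw.
apply/A1const_leP => //.
have /A1const_leP-/(_ v0) Mv_le := vc.
have eq_maximal : maximal (EFin \o w) = maximal (fun x => H x * (v x)%:E).
  apply: maximal_ae_eq.
  - exact/measurable_EFinP.
  - by apply: (emeasurable_funM mH); exact/measurable_EFinP.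
  - by apply: filterS Hfin => x /Hw ->.
rewrite eq_maximal; apply: filterS2 Hfin Mv_le => x Hx Mvx.
apply: (le_trans (maximalM H x mv v0 vQ)).
apply: (@le_trans _ _ ((c * v x)%:E * ((2 * K)%:E * H x))).
  apply: lee_pmul => //.
  - by rewrite maximalE; exact: wmaximal_ge0.
  - exact: wmaximal_ge0.
  - exact: wmaximal_rdf.
rewrite [leRHS]EFinM -(Hw x Hx) !EFinM le_eqVlt; apply/orP; left; apply/eqP.
by rewrite muleC -!muleA; congr (_ * (_ * _)); exact: muleCA.
Qed.


Variables (C D : R).
Hypothesis C0 : (0 < C)%R.

Let A : R := Num.max 1%R (2 * K * c)%R.
Let N : R := (2 ^+ n.+1 * A)%R.

Hypothesis D0 : (0 < D)%R.
Hypothesis Phi_doubling : forall s : R, (0 <= s)%R ->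
  (Phi (2 * (2 * (N * C)) * s) <= D * Phi s)%R.

Let A1' : (1 <= A)%R. Proof. by rewrite le_max lexx. Qed.

Let N0 : (0 < N)%R.
Proof. by rewrite mulr_gt0 ?exprn_gt0// (lt_le_trans ltr01). Qed.

Let L0 : (0 < 2 * (N * C))%R.
Proof. by rewrite mulr_gt0// mulr_gt0. Qed.

Let Phi_doubling_er s : 0 <= s ->
  er_map Phi ((2 * (2 * (N * C)))%:E * s) <= D%:E * er_map Phi s.
Proof.
case: s => [s|_|//]; first by rewrite lee_fin => s0; rewrite lee_fin Phi_doubling.
rewrite !gt0_muley ?lte_fin ?mulr_gt0//=.
exact: (lt_le_trans ltr01 A1').
Qed.

Let er_map_Phi_ge0 s : 0 <= s -> 0 <= er_map Phi s.
Proof.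
by case: s => [s|//|//]; rewrite !lee_fin; exact: young_ge0.
Qed.

(** The constant [2 * (N * C)] and an additional factor [2] are put on [g], where
    doubling turns them into [D]; the complementary term is left with a factor
    [1/2], which makes it absorbable. *)
Lemma duality_pointwise (g H : T -> \bar R) x :
  (forall x, 0 <= g x) -> (forall x, 0 <= H x) ->
  (2 * (N * C))%:E * (g x * (H x * (v x)%:E))
  <= D%:E * (er_map Phi (g x * (a x)%:E) * (v x)%:E)
     + (2^-1)%:E * (Psi (H x * (a x)^-1%:E) * (v x)%:E).
Proof.
move=> g0 H0; set s := g x * (a x)%:E; set t := H x * (a x)^-1%:E.
have s0 : 0 <= s by rewrite mule_ge0// lee_fin ltW.
have t0 : 0 <= t by rewrite mule_ge0// lee_fin ltW.
have gHE : g x * (H x * (v x)%:E) = s * t * (v x)%:E.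
  rewrite /s /t !muleA; congr (_ * _).
  by rewrite [RHS]muleAC -(muleA (g x)) -EFinM mulfV ?gt_eqF// mule1.
have LE : (2 * (N * C))%:E * (s * t) =
    ((2 * (2 * (N * C)))%:E * s) * ((2^-1)%:E * t).
  by rewrite [RHS]muleACA -EFinM; congr (_%:E * _); field.
rewrite gHE muleA LE [D%:E * _]muleA [_ * (Psi t * _)]muleA -ge0_muleDl; last 2 first.
- by rewrite mule_ge0 ?lee_fin ?er_map_Phi_ge0// ltW.
- by rewrite mule_ge0 ?lee_fin ?invr_ge0// complementary_ge0.
apply: lee_wpmul2r; first by rewrite lee_fin ltW.
apply: (le_trans (young_inequality PhiY _ _)).
- by apply: mule_ge0 => //; rewrite lee_fin mulr_ge0// ltW.
- by apply: mule_ge0 => //; rewrite lee_fin invr_ge0.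
apply: leeD; first exact: Phi_doubling_er.
by apply: complementaryZ_le => //; lra.
Qed.

Variables f g : T -> \bar R.
Hypothesis mf : measurable_fun [set: T] f.
Hypothesis mg : measurable_fun [set: T] g.
Hypothesis f0 : forall x, 0 <= f x.
Hypothesis g0 : forall x, 0 <= g x.
Hypothesis weighted_fg : forall w : T -> R,
  measurable_fun [set: T] w -> (forall x, 0 < w x)%R ->
  A1const (EFin \o w) = A%:E ->
  \int[mu]_x (f x * (w x)%:E) <= C%:E * \int[mu]_x (g x * (w x)%:E).

Let mPhi (s : T -> \bar R) : measurable_fun [set: T] s -> (forall x, 0 <= s x) ->
  measurable_fun [set: T] (fun x => er_map Phi (s x) * (v x)%:E).
Proof.
move=> ms s0; apply: emeasurable_funM; last exact/measurable_EFinP.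
exact: measurable_er_map_young.
Qed.

(** The product of [v] and of the majorant of [h] is an [A1] weight, and changing it
    by a factor of at most [N] gives it the constant for which [weighted_fg]
    holds. *)
Lemma weighted_rdf (h : T -> \bar R) : measurable_fun [set: T] h ->
  (forall x, 0 <= h x) -> 0 < \int[mu]_x (h x * (v x)%:E) ->
  \int[mu]_x (Psi (h x * (a x)^-1%:E) * (v x)%:E) < +oo ->
  \int[mu]_x (f x * (h x * (v x)%:E))
  <= (2 * (N * C))%:E * \int[mu]_x (g x * (rdf v K h x * (v x)%:E)).
Proof.
move=> mh h0 hv0 Psih.
have [w [mw w0 Hw wc]] := A1_rdf mh h0 hv0 Psih.
have [w' [mw' w'0 w'w w'A]] := @A1const_prescribed _ _ w _ A n_gt0 w0 mw wc
  ltac:(by rewrite le_max lexx orbT) A1'.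
have mH : measurable_fun [set: T] (rdf v K h) by exact: measurable_rdf.
have H0 x : 0 <= rdf v K h x by exact: rdf_ge0.
have mM (s : T -> \bar R) (t : T -> R) : measurable_fun [set: T] s ->
    measurable_fun [set: T] t -> measurable_fun [set: T] (fun x => s x * (t x)%:E).
  by move=> ms mt; apply: (emeasurable_funM ms); exact/measurable_EFinP.
have M0 (s : T -> \bar R) (t : T -> R) x : (forall x, 0 <= s x) ->
    (forall x, 0 < t x)%R -> 0 <= s x * (t x)%:E.
  by move=> s0 t0; rewrite mule_ge0// lee_fin ltW.
have rdf_w (s : T -> \bar R) : measurable_fun [set: T] s ->
    \int[mu]_x (s x * (rdf v K h x * (v x)%:E)) = \int[mu]_x (s x * (w x)%:E).
  move=> ms; apply: (ae_eq_integral _ _ measurableT).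
  - exact: (emeasurable_funM ms (mM _ _ mH mv)).
  - exact: mM.
  - by apply: filterS Hw => x -> _.
have mfw := mM _ _ mf mw; have mfw' := mM _ _ mf mw'.
have mgw := mM _ _ mg mw; have mgw' := mM _ _ mg mw'.
apply: (@le_trans _ _ (2%:E * \int[mu]_x (f x * (w x)%:E))).
  have mfH := emeasurable_funM mf (mM _ _ mH mv).
  rewrite -(rdf_w _ mf) -(ge0_integralZl_EFin _ measurableT _ mfH (ler0n _ 2)).
    2: by move=> x _; rewrite mule_ge0// M0.
  apply: (ge0_le_integral _ measurableT).
  - by move=> x _; rewrite mule_ge0// M0.
  - exact: (emeasurable_funM mf (mM _ _ mh mv)).
  - by apply: (emeasurable_funM _ mfH); exact: measurable_cst.
  move=> x _; rewrite [leRHS]muleCA; apply: lee_wpmul2l => //.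
  rewrite muleA; apply: lee_wpmul2r; first by rewrite lee_fin ltW.
  exact: le_rdf.
rewrite (rdf_w _ mg) EFinM -muleA; apply: lee_wpmul2l => //.
apply: (@le_trans _ _ (N%:E * \int[mu]_x (f x * (w' x)%:E))).
  rewrite -(ge0_integralZl_EFin _ measurableT _ mfw' (ltW N0)); last first.
    by move=> x _; exact: M0.
  apply: (ge0_le_integral _ measurableT _ mfw).
  - by move=> x _; exact: M0.
  - by apply: (emeasurable_funM _ mfw'); exact: measurable_cst.
  move=> x _; rewrite [leRHS]muleCA -EFinM; apply: lee_wpmul2l => //.
  by have /andP[_] := w'w x.
rewrite (EFinM N) -muleA; apply: lee_wpmul2l; first by rewrite lee_fin ltW.
apply: (le_trans (weighted_fg mw' w'0 w'A)); apply: lee_wpmul2l.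
  by rewrite lee_fin ltW.
apply: (ge0_le_integral _ measurableT _ mgw' mgw).
- by move=> x _; exact: M0.
- by move=> x _; apply: lee_wpmul2l => //; have /andP[] := w'w x.
Qed.

(** Duality: [Phi (F x) = F x * (Phi (F x) / F x)], and the complementary modular
    of the second factor is at most the modular [J] of [F].  This leads to an
    inequality with [J / 2] on the right, which can be absorbed as [J] is
    finite. *)
Lemma extrapolation_finite (F : T -> R) : measurable_fun [set: T] F ->
  (forall x, 0 <= F x)%R -> (forall x, (F x)%:E <= f x * (a x)%:E) ->
  \int[mu]_x (er_map Phi (F x)%:E * (v x)%:E) < +oo ->
  \int[mu]_x (er_map Phi (F x)%:E * (v x)%:E)
  <= (2 * D)%:E * \int[mu]_x (er_map Phi (g x * (a x)%:E) * (v x)%:E).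
Proof.
move=> mF F0 Ff; set J := \int[mu]_x _ => Jy.
set I := \int[mu]_x (er_map Phi (g x * (a x)%:E) * (v x)%:E).
have mPhiF : measurable_fun [set: T] (fun x => er_map Phi (F x)%:E * (v x)%:E).
  apply: mPhi; first exact/measurable_EFinP.
  by move=> x; rewrite lee_fin.
have PhiF0 x : 0 <= er_map Phi (F x)%:E * (v x)%:E.
  by rewrite mule_ge0 ?er_map_Phi_ge0 ?lee_fin// ltW.
have s0 x : 0 <= g x * (a x)%:E by rewrite mule_ge0// lee_fin ltW.
have ms : measurable_fun [set: T] (fun x => g x * (a x)%:E).
  by apply: (emeasurable_funM mg); exact/measurable_EFinP.
have mPhig := mPhi ms s0.
have Phig0 x : 0 <= er_map Phi (g x * (a x)%:E) * (v x)%:E.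
  by rewrite mule_ge0 ?er_map_Phi_ge0// lee_fin ltW.
have I0 : 0 <= I by apply: integral_ge0 => x _; exact: Phig0.
have [J_eq0|J_neq0] := eqVneq J 0.
  by rewrite J_eq0 mule_ge0// lee_fin mulr_ge0 ?ltW.
(* where F vanishes, the division by zero returns 0 *)
pose q x := (Phi (F x) / F x)%R.
have q0 x : (0 <= q x)%R by rewrite divr_ge0// young_ge0.
have qF x : (F x * q x = Phi (F x))%R.
  rewrite /q; have [->|Fx] := eqVneq (F x) 0%R.
    by rewrite mul0r young0.
  by rewrite mulrC divfK.
have Psiq x : Psi (q x)%:E <= (Phi (F x))%:E.
  rewrite /q; have [->|Fx] := eqVneq (F x) 0%R.
    rewrite invr0 mulr0 young0//; apply: ge_ereal_sup => _ [r r0 <-].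
    by rewrite mule0 sub0e lee_fin oppr_le0 (young_ge0 PhiY)// ltW.
  by apply: complementary_quotient => //; rewrite lt_neqAle eq_sym Fx F0.
have mq : measurable_fun [set: T] q.
  apply: measurable_funM.
    apply/measurable_EFinP; apply: (measurable_er_map_young PhiY (g := EFin \o F)).
      exact/measurable_EFinP.
    by move=> x; rewrite lee_fin.
  rewrite (_ : (fun x => _) = (fun x => F x `^ (-1))%R); last first.
    by apply/funext => x; rewrite powR_inv1.
  exact: measurableT_comp (measurable_powR _) mF.
pose h x : \bar R := (q x * a x)%:E.
have h0 x : 0 <= h x by rewrite lee_fin mulr_ge0// ltW.
have mh : measurable_fun [set: T] h.
  by apply/measurable_EFinP; exact: measurable_funM.
have haV x : h x * (a x)^-1%:E = (q x)%:E.
  by rewrite /h -EFinM mulfK// gt_eqF.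
have mhv : measurable_fun [set: T] (fun x => h x * (v x)%:E).
  by apply: (emeasurable_funM mh); exact/measurable_EFinP.
have hv0 x : 0 <= h x * (v x)%:E by rewrite mule_ge0// lee_fin ltW.
have PsihJ : \int[mu]_x (Psi (h x * (a x)^-1%:E) * (v x)%:E) <= J.
  apply: (ge0_le_integral _ measurableT _ (measurable_Psi mh) mPhiF).
  - by move=> x _; exact: Psi_ge0.
  - move=> x _; rewrite haV; apply: lee_wpmul2r; first by rewrite lee_fin ltW.
    exact: Psiq.
have hv_gt0 : 0 < \int[mu]_x (h x * (v x)%:E).
  rewrite lt0e integral_ge0// andbT; apply: contra J_neq0 => /eqP hv_eq0.
  have /(ae_eq_integral_abs mu measurableT mhv) hv_ae :
      \int[mu]_x `|h x * (v x)%:E| = 0.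
    by rewrite -[RHS]hv_eq0; apply: eq_integral => x _; rewrite gee0_abs.
  rewrite /J (ae_eq_integral (cst 0) _ measurableT mPhiF).
  - by rewrite integral0.
  - exact: measurable_cst.
  - apply: filterS hv_ae => x /(_ Logic.I) hx _ /=.
    have -> : (Phi (F x))%:E = 0; last by rewrite mul0e.
    rewrite -qF; move: hx => /eqP; rewrite /h -EFinM eqe.
    rewrite mulf_eq0 (gt_eqF (v0 x)) orbF mulf_eq0 (gt_eqF (a0 x)) orbF => /eqP ->.
    by rewrite mulr0.
pose H := rdf v K h.
have mH : measurable_fun [set: T] H by exact: measurable_rdf.
have H0 x : 0 <= H x by exact: rdf_ge0.
have mPsiH := measurable_Psi mH.
have PsiHJ : \int[mu]_x (Psi (H x * (a x)^-1%:E) * (v x)%:E) <= J.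
  apply: le_trans PsihJ.
  exact: (rdf_modular v0 mv K1 mh h0 PhiY aV0 maV Mv_modular).
have JDI : J <= D%:E * I + (2^-1)%:E * J.
  apply: (@le_trans _ _ (\int[mu]_x (f x * (h x * (v x)%:E)))).
    apply: (ge0_le_integral _ measurableT _ mPhiF).
    - by move=> x _; exact: PhiF0.
    - exact: emeasurable_funM.
    - move=> x _; rewrite /= -qF /h.
      rewrite (_ : f x * _ = f x * (a x)%:E * ((q x)%:E * (v x)%:E)).
        rewrite EFinM -muleA; apply: lee_wpmul2r; last exact: Ff.
        by rewrite mule_ge0// lee_fin// ltW.
      by rewrite -!EFinM -!muleA -EFinM mulrCA mulrA.
  apply: (le_trans (weighted_rdf mh h0 hv_gt0 (le_lt_trans PsihJ Jy))).
  have mgH : measurable_fun [set: T] (fun x => g x * (H x * (v x)%:E)).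
    apply: (emeasurable_funM mg); apply: (emeasurable_funM mH).
    exact/measurable_EFinP.
  have gH0 x : 0 <= g x * (H x * (v x)%:E).
    by rewrite !mule_ge0// lee_fin ltW.
  rewrite -(ge0_integralZl_EFin _ measurableT _ mgH (ltW L0)); last first.
    by move=> x _; exact: gH0.
  apply: (@le_trans _ _ (\int[mu]_x
      (D%:E * (er_map Phi (g x * (a x)%:E) * (v x)%:E)
       + (2^-1)%:E * (Psi (H x * (a x)^-1%:E) * (v x)%:E)))).
    apply: (ge0_le_integral _ measurableT).
    - by move=> x _; rewrite mule_ge0// lee_fin ltW.
    - by apply: (emeasurable_funM _ mgH); exact: measurable_cst.
    - apply: emeasurable_funD.
        by apply: (emeasurable_funM _ mPhig); exact: measurable_cst.
      by apply: (emeasurable_funM _ mPsiH); exact: measurable_cst.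
    - by move=> x _; exact: duality_pointwise.
  rewrite (ge0_integralD _ measurableT); last 4 first.
  - by move=> x _; rewrite mule_ge0// lee_fin ltW.
  - by apply: (emeasurable_funM _ mPhig); exact: measurable_cst.
  - by move=> x _; rewrite mule_ge0 ?Psi_ge0// lee_fin invr_ge0.
  - by apply: (emeasurable_funM _ mPsiH); exact: measurable_cst.
  rewrite (ge0_integralZl_EFin _ measurableT _ mPhig (ltW D0)); last first.
    by move=> x _; exact: Phig0.
  rewrite (ge0_integralZl_EFin _ measurableT _ mPsiH); last 2 first.
  - by move=> x _; exact: Psi_ge0.
  - by rewrite invr_ge0.
  by rewrite leeD2l// lee_wpmul2l// lee_fin invr_ge0.
have [Iy|Iy] := eqVneq I +oo.
  by rewrite Iy gt0_muley ?leey// lte_fin mulr_gt0.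
have J0 : 0 <= J by apply: integral_ge0 => x _; exact: PhiF0.
move: JDI; rewrite -(fineK (_ : I \is a fin_num)) ?ge0_fin_numE ?ltey//.
rewrite -(fineK (_ : J \is a fin_num)) ?ge0_fin_numE//.
by rewrite -!EFinM -EFinD !lee_fin; lra.
Qed.

(** The modular of [f * a] may be infinite, so [extrapolation_finite] is applied
    to truncations of [f * a] that are bounded and vanish outside bounded sets on
    which [v] is bounded. *)
Lemma modular_extrapolation :
  \int[mu]_x (er_map Phi (f x * (a x)%:E) * (v x)%:E)
  <= (2 * D)%:E * \int[mu]_x (er_map Phi (g x * (a x)%:E) * (v x)%:E).
Proof.
have s0 x : 0 <= f x * (a x)%:E by rewrite mule_ge0// lee_fin ltW.
have ms : measurable_fun [set: T] (fun x => f x * (a x)%:E).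
  by apply: (emeasurable_funM mf); exact/measurable_EFinP.
pose E k : set T := big_cube k `&` [set x | (v x <= k%:R)%R].
have mE k : measurable (E k).
  apply: (measurable_fun_le _ (measurable_funTS mv) (measurable_cst _)).
  exact/cubes_measurable/cubes_big_cube.
pose m k x : R := fine (mine (f x * (a x)%:E) k%:R%:E).
pose F k x : R := (m k x * \1_(E k) x)%R.
have min_fin k x : mine (f x * (a x)%:E) k%:R%:E \is a fin_num.
  by rewrite ge0_fin_numE ?le_min ?s0 ?lee_fin//= gt_min ltry orbT.
have mkE k x : (m k x)%:E = mine (f x * (a x)%:E) k%:R%:E by rewrite fineK.
have m0 k x : (0 <= m k x)%R.
  by rewrite fine_ge0// le_min s0 lee_fin/=.
have F0 k x : (0 <= F k x)%R by rewrite mulr_ge0// indicE.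
have mF k : measurable_fun [set: T] (F k).
  apply: measurable_funM; last exact: measurable_indic.
  apply: (measurableT_comp (fine_measurable measurableT)).
  by apply: measurable_mine => //; exact: measurable_cst.
have F_le k x : (F k x <= m k x)%R.
  by rewrite ler_piMr// indicE; case: (x \in E k).
have Ff k x : (F k x)%:E <= f x * (a x)%:E.
  apply: (@le_trans _ _ (mine (f x * (a x)%:E) k%:R%:E)).
    by rewrite -mkE lee_fin.
  by rewrite ge_min lexx.
have Fk k x : (F k x <= k%:R)%R.
  by rewrite (le_trans (F_le k x))// -lee_fin mkE ge_min lexx orbT.
have FE k x : E k x -> (F k x)%:E = mine (f x * (a x)%:E) k%:R%:E.
  by move=> Ex; rewrite /F indicE mem_set// mulr1 mkE.
have F_nd x : {homo (fun k => F k x) : j k / (j <= k)%N >-> (j <= k)%R}.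
  move=> j k jk; have [Ex|Ex] := pselect (E j x); last first.
    by rewrite {1}/F indicE memNset// mulr0.
  have Ekx : E k x.
    have [bx vx] := Ex; split.
      by have /subsetPset := @nondecreasing_big_cube R n _ _ jk; apply.
    by rewrite /= (le_trans vx)// ler_nat.
  rewrite -lee_fin !FE//; apply: le_min2 => //.
  by rewrite lee_fin ler_nat.
pose G k x := er_map Phi (F k x)%:E * (v x)%:E.
have G0 k x : 0 <= G k x.
  by rewrite mule_ge0 ?er_map_Phi_ge0 ?lee_fin// ltW.
have mG k : measurable_fun [set: T] (G k).
  apply: mPhi; first exact/measurable_EFinP.
  by move=> x; rewrite lee_fin.
have G_nd x : nondecreasing_seq (G^~ x).
  move=> j k jk; apply: lee_wpmul2r; first by rewrite lee_fin ltW.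
  by rewrite lee_fin le_young// F_nd.
have G_lim x : limn (G^~ x) = er_map Phi (f x * (a x)%:E) * (v x)%:E.
  have Ex : \forall k \near \oo, E k x.
    near=> k; split; first by near: k; exact: big_cube_near.
    by near: k; exact: nbhs_infty_ger.
  apply: cvg_lim => //; have := s0 x; rewrite /G.
  case fax : (f x * (a x)%:E) => [s|//|//].
    rewrite lee_fin => s_ge0; apply: cvg_near_cst.
    near=> k; rewrite FE; last by near: k.
    rewrite fax min_l// lee_fin; near: k; exact: nbhs_infty_ger.
  move=> _; rewrite /= gt0_mulye ?lte_fin//.
  apply/cvgeyPge => M; have [t t0 Mt] := young_unbounded PhiY (M / v x).
  near=> k.
  have tk : (t <= k%:R)%R by near: k; exact: nbhs_infty_ger.
  have -> : F k x = (k%:R)%R.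
    apply: EFin_inj; rewrite FE; last by near: k.
    by rewrite fax min_r// leey.
  rewrite -EFinM lee_fin -ler_pdivrMr//.
  by rewrite (le_trans Mt)// le_young.
rewrite (eq_integral (fun x => limn (G^~ x))); last by move=> x _; rewrite G_lim.
rewrite (monotone_convergence _ measurableT mG); last 2 first.
- by move=> k x _; exact: G0.
- by move=> x _; exact: G_nd.
apply: lime_le.
  apply: ereal_nondecreasing_is_cvgn => j k jk.
  apply: (ge0_le_integral _ measurableT _ (mG j) (mG k)) => x _; first exact: G0.
  exact: G_nd.
apply: nearW => k; apply: extrapolation_finite => //.
apply: (@le_lt_trans _ _ (\int[mu]_x ((Phi k%:R * k%:R)%:E * (\1_(big_cube k) x)%:E))).
  apply: (ge0_le_integral _ measurableT _ (mG k)).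
  - by move=> x _; exact: G0.
  - apply: emeasurable_funM; first exact: measurable_cst.
    apply/measurable_EFinP; apply: measurable_indic.
    exact/cubes_measurable/cubes_big_cube.
  move=> x _; rewrite /G /=.
  have [[bx vx]|Ex] := pselect (E k x); last first.
    rewrite /F indicE memNset// mulr0 young0// mul0e mule_ge0// lee_fin.
    by rewrite mulr_ge0// (young_ge0 PhiY).
  rewrite indicE mem_set// mule1 -EFinM lee_fin; apply: ler_pM => //.
  - exact: (young_ge0 PhiY).
  - exact: ltW.
  - exact: (le_young PhiY).
have mB : measurable (big_cube k : set T) by exact/cubes_measurable/cubes_big_cube.
rewrite (ge0_integralZl_EFin _ measurableT); last 3 first.
- by move=> x _; rewrite lee_fin indicE.
- by apply/measurable_EFinP; exact: measurable_indic.
- by rewrite mulr_ge0// (young_ge0 PhiY).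
rewrite integral_indic// setIT lte_mul_pinfty ?lee_fin ?mulr_ge0 ?(young_ge0 PhiY)//.
by rewrite ltey_eq cubes_leb_fin//; exact: cubes_big_cube.
Unshelve. all: by end_near. Qed.

End modular_extrapolation.

(** * Reduction to positive real weights *)

Section weight_versions.
Variables (R : realType) (n : nat).
Local Notation T := (Rn R n).
Local Notation mu := (leb R n).

(** A weight may vanish or be infinite on a null set; the pointwise arguments above
    need a version without exceptional points. *)
Lemma weight_positive_version (w : T -> \bar R) : weight w ->
  exists w' : T -> R, [/\ measurable_fun [set: T] w', forall x, (0 < w' x)%R
    & {ae mu, forall x, w x = (w' x)%:E}].
Proof.
move=> [mw w_ae]; pose w' x : R := if 0 < w x < +oo then fine (w x) else 1%R.
exists w'; split.
- apply: measurable_fun_ifT; last exact: measurable_cst.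
    apply: measurable_and; apply: measurable_fun_lte => //; exact: measurable_cst.
  exact: (measurableT_comp (fine_measurable measurableT) mw).
- by move=> x; rewrite /w'; case: ifPn => // ?; exact: fine_gt0.
- apply: filterS w_ae => x wx; rewrite /w' wx fineK//.
  by have /andP[w0 wy] := wx; rewrite ge0_fin_numE// ltW.
Qed.

Lemma A1const_ae_eq (w w' : T -> \bar R) :
  measurable_fun [set: T] w -> measurable_fun [set: T] w' ->
  {ae mu, forall x, w x = w' x} -> A1const w = A1const w'.
Proof.
move=> mw mw' ww'; rewrite /A1const (maximal_ae_eq mw mw' ww') unlock.
case: ifPn => // _; apply: eq_ess_sup.
by apply: filterS ww' => x /= ->.
Qed.

Lemma weight_EFin (w : T -> R) : measurable_fun [set: T] w ->
  (forall x, 0 < w x)%R -> weight (EFin \o w).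
Proof.
move=> mw w0; split; first exact/measurable_EFinP.
by apply: nearW => x /=; rewrite lte_fin w0 ltry.
Qed.

Lemma integral_le_of_wnorm_le (w : T -> \bar R) (p C : R) (f g : T -> \bar R) :
  (0 < p)%R -> (0 < C)%R -> (forall x, 0 <= w x) ->
  (forall x, 0 <= f x) -> (forall x, 0 <= g x) ->
  wnorm w p f <= C%:E * wnorm w p g ->
  \int[mu]_x (f x `^ p * w x) <= (C `^ p)%:E * \int[mu]_x (g x `^ p * w x).
Proof.
move=> p0 C0 w0 f0 g0; rewrite /wnorm.
have absE (h : T -> \bar R) : (forall x, 0 <= h x) ->
    \int[mu]_x (`|h x| `^ p * w x) = \int[mu]_x (h x `^ p * w x).
  by move=> h0; apply: eq_integral => x _; rewrite gee0_abs.
have int0 (h : T -> \bar R) : 0 <= \int[mu]_x (h x `^ p * w x).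
  by apply: integral_ge0 => x _; rewrite mule_ge0// poweR_ge0.
rewrite !absE// => le_fg.
have powK (y : \bar R) : 0 <= y -> (y `^ p^-1) `^ p = y.
  by move=> y0; rewrite -poweRrM mulVf ?gt_eqF// poweRe1.
have : (\int[mu]_x (f x `^ p * w x)) `^ p^-1 `^ p
    <= (C%:E * (\int[mu]_x (g x `^ p * w x)) `^ p^-1) `^ p.
  apply: (gt0_ler_poweR (ltW p0)) le_fg; rewrite in_itv/= leey andbT.
    exact: poweR_ge0.
  by rewrite mule_ge0 ?poweR_ge0// lee_fin ltW.
by rewrite poweRM ?poweR_ge0 ?lee_fin ?(ltW C0)// !powK.
Qed.

End weight_versions.

Unset Implicit Arguments.
Set Strict Implicit.

Theorem theorem4p4 (R : realType) (n : nat) (n_gt0 : (0 < n)%N)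
    (F : set ((Rn R n -> \bar R) * (Rn R n -> \bar R)))
    (FE : extrapolation_family F)
    (Phi : R -> R) (PhiY : young Phi)
    (Phi_indices : [/\ 1 < lower_index Phi, lower_index Phi <= upper_index Phi
                     & upper_index Phi < +oo])
    (u v : Rn R n -> \bar R) (wu : weight u) (wv : weight v) (v_A1 : A1 v)
    (p0 : R) (p0_gt0 : (0 < p0)%R)
    (extrapolation_hyp : exists C : R -> R, (forall a, (0 < C a)%R) /\
      forall w, A1 w -> forall f g, F (f, g) ->
        wnorm w p0 f <= (C (fine (A1const w)))%:E * wnorm w p0 g)
    (maximal_hyp : exists K0 : R, (0 < K0)%R /\
      forall f : Rn R n -> \bar R, measurable_fun [set: Rn R n] f ->
        \int[leb R n]_x
          (complementary Phi (wmaximal v f x * u x `^ (- p0)) * v x)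
        <= K0%:E * \int[leb R n]_x
          (complementary Phi (`|f x| * u x `^ (- p0)) * v x)) :
  exists C : R, (0 < C)%R /\
    forall f g, F (f, g) ->
      \int[leb R n]_x (er_map Phi (f x `^ p0 * u x `^ p0) * v x)
      <= C%:E * \int[leb R n]_x (er_map Phi (g x `^ p0 * u x `^ p0) * v x).
Proof.
have [u' [mu' u'0 uu']] := weight_positive_version wu.
have [v' [mv' v'0 vv']] := weight_positive_version wv.
have [[mu_ _] [mv_ _]] := (wu, wv).
have [_ v_A1y] := v_A1.
have [C [C0 extrapolation]] := extrapolation_hyp.
have [K0 [K0_gt0 Mv_modular]] := maximal_hyp.
have [_ _ upper_lty] := Phi_indices.
have mEv' : measurable_fun [set: Rn R n] (EFin \o v') by exact/measurable_EFinP.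
pose c := fine (A1const v).
have vc : A1const (EFin \o v') <= c%:E.
  rewrite -(A1const_ae_eq mv_ mEv' vv') /c fineK//.
  by rewrite ge0_fin_numE ?Lnorm_ge0.
(* a constant below 1 would make the coefficients of the series sum to more than 1 *)
pose K := Num.max 1%R K0.
have K1 : (1 <= K)%R by rewrite le_max lexx.
pose a x := (u' x `^ p0)%R.
have a0 x : (0 < a x)%R by exact: powR_gt0.
have ma : measurable_fun [set: Rn R n] a.
  exact: measurableT_comp (measurable_powR _) mu'.
have u_a : {ae leb R n, forall x, u x `^ p0 = (a x)%:E}.
  by apply: filterS uu' => x ->; rewrite poweR_EFin.
have u_aV : {ae leb R n, forall x, u x `^ (- p0) = ((a x)^-1)%:E}.
  by apply: filterS uu' => x ->; rewrite poweR_EFin powRN.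
have mpow (h : Rn R n -> \bar R) p : measurable_fun [set: Rn R n] h ->
    measurable_fun [set: Rn R n] (fun x => h x `^ p).
  exact: measurableT_comp (measurable_poweR p).
have mPsi (h s t : Rn R n -> \bar R) : measurable_fun [set: Rn R n] h ->
    measurable_fun [set: Rn R n] s -> measurable_fun [set: Rn R n] t ->
    measurable_fun [set: Rn R n] (fun x => complementary Phi (h x * s x) * t x).
  move=> mh ms mt; apply: (emeasurable_funM _ mt).
  apply: (measurableT_comp (@measurable_complementary R Phi)).
  exact: (emeasurable_funM mh ms).
have maV : measurable_fun [set: Rn R n] (fun x => ((a x)^-1)%:E).
  apply/measurable_EFinP; rewrite (_ : (fun x => _) = (fun x => u' x `^ (- p0))%R).
    exact: measurableT_comp (measurable_powR _) mu'.
  by apply/funext => x; rewrite powRN.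
have PsiE (h : Rn R n -> \bar R) : measurable_fun [set: Rn R n] h ->
    \int[leb R n]_x (complementary Phi (h x * u x `^ (- p0)) * v x) =
    \int[leb R n]_x (complementary Phi (h x * ((a x)^-1)%:E) * (v' x)%:E).
  move=> mh; apply: (ae_eq_integral _ _ measurableT).
  - exact: (mPsi _ _ _ mh (mpow _ _ mu_) mv_).
  - exact: (mPsi _ _ _ mh maV mEv').
  - by apply: filterS2 u_aV vv' => x -> -> _.
have maximal_a (f : Rn R n -> \bar R) : measurable_fun [set: Rn R n] f ->
    \int[leb R n]_x (complementary Phi
      (wmaximal (EFin \o v') f x * ((a x)^-1)%:E) * (v' x)%:E)
    <= K%:E * \int[leb R n]_x
      (complementary Phi (`|f x| * ((a x)^-1)%:E) * (v' x)%:E).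
  move=> mf; have maf := measurableT_comp (@abse_measurable R setT) mf.
  rewrite -(wmaximal_ae_eq mv_ mEv' mf vv').
  rewrite -(PsiE _ (measurable_wmaximal v f)) -(PsiE _ maf).
  apply: (le_trans (Mv_modular f mf)); apply: lee_wpmul2r.
    rewrite (PsiE _ maf); apply: integral_ge0 => x _; apply: mule_ge0.
      apply: (complementary_ge0 PhiY); apply: mule_ge0; first exact: abse_ge0.
      by rewrite lee_fin invr_ge0 ltW.
    by rewrite lee_fin ltW.
  by rewrite lee_fin le_max lexx orbT.
(* the common constant of all the weights to which the hypothesis is applied *)
pose A := Num.max 1%R (2 * K * c)%R.
pose B := (C A `^ p0)%R.
have B0 : (0 < B)%R by exact: powR_gt0.
pose M := (2 * (2 * (2 ^+ n.+1 * A * B)))%R.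
(* the maximum is there because doubling is stated for factors at least 1 *)
have [D D0 doubling] := young_doubling PhiY upper_lty
  (ltac:(by rewrite le_max lexx) : (1 <= Num.max 1 M)%R).
have M0 : (0 <= M)%R.
  rewrite !mulr_ge0// ?exprn_ge0// ?(ltW B0)//.
  by rewrite (le_trans ler01)// le_max lexx.
have doublingM s : (0 <= s)%R -> (Phi (M * s) <= D * Phi s)%R.
  move=> s0; apply: le_trans (doubling s s0); apply: le_young => //.
    exact: mulr_ge0.
  by rewrite ler_wpM2r// le_max lexx orbT.
exists (2 * D)%R; split; first by rewrite mulr_gt0.
move=> f g Ffg; have [mf f0 mg g0] := FE _ _ Ffg.
have PhiE (h : Rn R n -> \bar R) : measurable_fun [set: Rn R n] h ->
    \int[leb R n]_x (er_map Phi (h x `^ p0 * u x `^ p0) * v x) =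
    \int[leb R n]_x (er_map Phi (h x `^ p0 * (a x)%:E) * (v' x)%:E).
  move=> mh; apply: (ae_eq_integral _ _ measurableT).
  - apply: (emeasurable_funM _ mv_); apply: measurable_er_map_young => //.
      exact: (emeasurable_funM (mpow _ _ mh) (mpow _ _ mu_)).
    by move=> x; rewrite mule_ge0// poweR_ge0.
  - apply: (emeasurable_funM _ mEv'); apply: measurable_er_map_young => //.
      by apply: (emeasurable_funM (mpow _ _ mh)); exact/measurable_EFinP.
    by move=> x; rewrite mule_ge0 ?poweR_ge0// lee_fin ltW.
  - by apply: filterS2 u_a vv' => x -> -> _.
rewrite !PhiE//.
apply: (modular_extrapolation n_gt0 PhiY v'0 mv' vc a0 ma K1 maximal_a B0 D0
  doublingM (mpow _ _ mf) (mpow _ _ mg)).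
- by move=> x; exact: poweR_ge0.
- by move=> x; exact: poweR_ge0.
move=> w mw w0 wA; apply: integral_le_of_wnorm_le => //.
- by move=> x; rewrite lee_fin ltW.
have A1w : A1 (EFin \o w).
  by split; [exact: weight_EFin|rewrite wA ltry].
by have := extrapolation _ A1w _ _ Ffg; rewrite wA.
Qed.
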